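(* Let $k$ be a positive integer and let $G$ be a finite simple $3$-connected $k$-regular graph on $n$ vertices. Let $P=uvz$ be a path of $G$ (so $u,v,z$ are distinct, $uv,vz\in E(G)$) such that $\{u,v,z\}$ is not a cut-set of $G$, i.e. $G-\{u,v,z\}$ is connected. If $G$ does not belong to the class $\mathscr{H}$ with respect to $P$ and $n\leqslant 3k-6$, then $G$ has a Hamiltonian cycle containing the path $P$ (i.e. containing both edges $uv$ and $vz$).
   Context: All graphs are finite and simple. Class $\mathscr{H}$: for a $k$-regular graph $G$ and a path $P=uvz$ of $G$, we say that $G$ belongs to $\mathscr{H}$ with respect to $P$ if there is an integer $q\geqslant k$ such that $G$ is a $2$-connected $k$-regular graph on $2q+1$ vertices which contains two disjoint vertex sets $X$ and $Y$ with $Y$ independent, $\{u,v,z\}\subseteq X$, $|Y|=q$, $|X|=q+1$, $N(Y)\subseteq X$ (where $N(Y)$ is the set of vertices adjacent to some vertex of $Y$), and $v$ adjacent to both $u$ and $z$. A Hamiltonian cycle is a cycle containing all vertices of $G$. *)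

(* Defs.v *)
From mathcomp Require Import all_boot.
Set Implicit Arguments. Unset Strict Implicit. Unset Printing Implicit Defensive.

Definition simple_graph (T : finType) (e : rel T) : Prop :=
  symmetric e /\ irreflexive e.

Definition nbhd (T : finType) (e : rel T) (x : T) : {set T} := [set y | e x y].

Definition regular (T : finType) (e : rel T) (k : nat) : Prop :=
  forall x : T, #|nbhd e x| = k.

Definition induced_rel (T : finType) (e : rel T) (S : {set T}) : rel T :=
  fun x y => [&& x \in S, y \in S & e x y].

Definition connected_on (T : finType) (e : rel T) (S : {set T}) : Prop :=
  forall x y, x \in S -> y \in S -> connect (induced_rel e S) x y.

Definition connected_minus (T : finType) (e : rel T) (S : {set T}) : Prop :=
  connected_on e (~: S).

Definition k_connected (T : finType) (e : rel T) (k : nat) : Prop :=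
  k < #|T| /\ forall S : {set T}, #|S| < k -> connected_minus e S.

Definition independent (T : finType) (e : rel T) (Y : {set T}) : Prop :=
  forall x y, x \in Y -> y \in Y -> ~~ e x y.

Definition nbhd_set (T : finType) (e : rel T) (Y : {set T}) : {set T} :=
  [set x | [exists y in Y, e y x]].

Definition in_class_H (T : finType) (e : rel T) (k : nat) (u v z : T) : Prop :=
  exists q : nat,
    [/\ k <= q, #|T| = q.*2.+1, k_connected e 2, regular e k &
    exists X Y : {set T},
      [/\ [disjoint X & Y], independent e Y,
          [/\ u \in X, v \in X & z \in X],
          #|Y| = q /\ #|X| = q.+1 &
          nbhd_set e Y \subset X /\ (e v u && e v z)]].

Definition hamiltonian_cycle (T : finType) (e : rel T) (c : seq T) : Prop :=
  [/\ uniq c, 3 <= size c, forall x : T, x \in c & cycle e c].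

Definition cycle_has_edge (T : finType) (c : seq T) (x y : T) : Prop :=
  next c x = y \/ next c y = x.

(* Main.v *)
Require Import Defs.
From mathcomp Require Import all_boot zify.
Set Implicit Arguments. Unset Strict Implicit. Unset Printing Implicit Defensive.

(** Deleting all edges at v except vu and vz leaves a graph f in which every
    cycle through v contains the path P, so it suffices to find a Hamiltonian
    f-cycle; let c be a longest f-cycle through v.

    The vertices off c are independent.  If a component K of the rest had two
    vertices, it would have two attachments a1, a2 on c, and a vertex w of K
    together with the successors p1, p2 of a1, a2 would satisfy
    d(w) + d(p1) + d(p2) <= n + 2: any excess lets one reroute c through K to a
    longer cycle.  But the three degrees sum to at least 3(k - 1) > n + 2.

    If v0 is off c, Woodall's hopping argument closes N(v0) to a set X on c
    without consecutive vertices, and Y is the set of vertices of c, other than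
    v, between two vertices of X.  Then Y + v0 is independent with all its
    neighbours in X + v, and a path on V(c) between two vertices of X that
    respects Y closes up through v0.  Hence the first (or last) vertices of
    segments of c - X are pairwise nonadjacent, and a segment cannot be inserted
    between two consecutive vertices of another one.  By regularity, with s the
    number of segments having at least two vertices and avoiding v, the edges
    leaving X + v for the rest number at most k(s + 1), whereas the insertion
    property forces more than that, unless s = 0 and there is no rest.  In that
    case G lies in the class H. *)

(** * Walks and cyclic sequences *)

Section Lists.
Variable T : eqType.
Implicit Types (r : rel T) (s t : seq T) (a b x y : T).

(** Both endpoints belong to the list, so walks are joined by plain [++], and a walk whose last
    vertex is related to its first is a cycle as it stands. *)
Definition walk r a s b := if s is x :: s' then [&& x == a, path r a s' & last a s' == b] else false.

Lemma walk_cat r a s b c t d :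
  walk r a s b -> r b c -> walk r c t d -> walk r a (s ++ t) d.
Proof.
case: s => // x s /and3P[/eqP-> ps /eqP lb] rbc; case: t => // y t /and3P[/eqP-> pt ld].
by rewrite /= eqxx cat_path ps lb /= rbc pt /= last_cat /=.
Qed.

Lemma walk1 r a : walk r a [:: a] a. Proof. by rewrite /= !eqxx. Qed.

Lemma walk_rev r a s b : symmetric r -> walk r a s b -> walk r b (rev s) a.
Proof.
move=> rs; case: s => // x s /and3P[/eqP-> ps /eqP lb].
rewrite lastI rev_rcons lb /= eqxx -lb rev_path.
rewrite (eq_path (e' := r)) ?ps; last by move=> ? ?; rewrite rs.
by case: s {ps lb} => [|y s] /=; rewrite ?eqxx // rev_cons last_rcons eqxx.
Qed.

Lemma walk_cycle r a s b : walk r a s b -> r b a -> cycle r s.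
Proof. by case: s => // x s /and3P[/eqP-> ps /eqP lb] rba; rewrite /= rcons_path ps lb. Qed.

Lemma cycle_walk r x s : cycle r (x :: s) -> walk r x (x :: s) (last x s) /\ r (last x s) x.
Proof. by rewrite /= rcons_path => /andP[-> ->]; rewrite !eqxx. Qed.

Lemma walk_cat_inv r a s x y t b : walk r a (rcons s x ++ y :: t) b ->
  [/\ walk r a (rcons s x) x, r x y & walk r y (y :: t) b].
Proof.
case: s => [|w s] /=.
  by case/and3P=> /eqP<- /andP[-> ->] ->; rewrite !eqxx.
rewrite cat_path last_cat /= !last_rcons => /and3P[wa /and3P[-> -> ->] ->].
by rewrite wa !eqxx.
Qed.

Lemma sub_walk r r' a s b : subrel r r' -> walk r a s b -> walk r' a s b.
Proof. by move=> sr; case: s => // x s /and3P[xa /(sub_path sr) ps ls] /=; rewrite xa ps ls. Qed.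

Lemma walk_mem r a s b : walk r a s b -> (a \in s) /\ (b \in s).
Proof.
by case: s => // x s /and3P[/eqP-> _ /eqP<-]; rewrite mem_head mem_last.
Qed.

Lemma walk_ne r a s b : walk r a s b -> exists s', s = a :: s'.
Proof. by case: s => // x s /and3P[/eqP-> _ _]; exists s. Qed.

Lemma walk_last r a s b : walk r a s b -> exists s', s = rcons s' b.
Proof. by case: s => // x s /and3P[/eqP-> _ /eqP<-]; exists (belast a s); rewrite lastI. Qed.

(* Charge a hit of A at position i to slot i - 1, of B to slot i and of W to slot
   i + 1: no slot is charged twice, except possibly the one of v.  [free]
   records that the first slot can still take a charge from W. *)
Lemma triple_count (A B W : pred T) v x0 s :
  (forall s1 x y s2, x0 :: s = s1 ++ x :: y :: s2 -> ~~ (A y && B x) /\ ~~ (W x && B y)) ->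
  (forall s1 x m y s2, x0 :: s = s1 ++ x :: m :: y :: s2 -> m != v -> ~~ (W x && A y)) ->
  count A s + count B (x0 :: s) + count W (x0 :: s) <= (size s).+2 + count_mem v s.
Proof.
pose free x t := ~~ (if t is y :: _ then A y else false) && ~~ B x.
suff: forall s x0,
  (forall s1 x y s2, x0 :: s = s1 ++ x :: y :: s2 -> ~~ (A y && B x) /\ ~~ (W x && B y)) ->
  (forall s1 x m y s2, x0 :: s = s1 ++ x :: m :: y :: s2 -> m != v -> ~~ (W x && A y)) ->
  count A s + count B (x0 :: s) + count W (x0 :: s) + free x0 s <= (size s).+2 + count_mem v s.
  by move=> H h1 h2; have := H _ _ h1 h2; lia.
elim=> [|y t IH] x h1 h2.
  by rewrite /free /=; case: (B x); case: (W x).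
have [] := h1 [::] x y t erefl.
have {IH}: count A t + count B (y :: t) + count W (y :: t) + free y t <= (size t).+2 + count_mem v t.
  apply: IH => [s1 p q s2 E|s1 p m q s2 E]; first by apply: (h1 (x :: s1)); rewrite E.
  by apply: (h2 (x :: s1)); rewrite E.
have : W x -> ~~ B y -> (y != v) ==> free y t.
  move=> Wx nB; apply/implyP => yv; rewrite /free nB andbT.
  by case: t h1 h2 => // m t h1 h2; have := h2 [::] x y m t erefl yv; rewrite Wx.
have frE : free x (y :: t) = ~~ A y && ~~ B x by [].
rewrite {}frE /= eq_sym; move: (free y t) (count_mem v t) (count A t) (count B t) (count W t) (size t).
move=> fr nv nA nB nW n; case: (v == y) => /=; case: (W x); case: (A y); case: (B x); case: (B y);
  case: fr => //= Himp Hc Hx Hy; try (by have := Himp isT isT);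
  lia.
Qed.

(** Off [c] the function [next c] is the identity; without the membership test every such vertex
    would be related to itself. *)
Definition next_rel (c : seq T) : rel T := fun x y => (x \in c) && (y == next c x).

Lemma next_rel_cycle c : uniq c -> cycle (next_rel c) c.
Proof.
move=> uc; have := cycle_next uc; case: c uc => // x c uc.
rewrite /cycle => pc; apply: sub_in_path (pc); last first.
  apply/allP => y yx; move: yx; rewrite inE mem_rcons inE orbA orbb -in_cons; exact: id.
by move=> a b ac _ /eqP<-; rewrite /next_rel ac eqxx.
Qed.

Lemma next_rel_sub c r x y : cycle r c -> next_rel c x y -> r x y.
Proof. by move=> cc /andP[xc /eqP->]; apply: next_cycle. Qed.

Lemma next_rel_rot c i : uniq c -> next_rel (rot i c) =2 next_rel c.
Proof. by move=> uc x y; rewrite /next_rel mem_rot next_rot. Qed.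

Lemma next_rel_rev c x y : uniq c -> next_rel (rev c) x y = next_rel c y x.
Proof.
move=> uc; rewrite /next_rel mem_rev next_rev //.
apply/idP/idP => /andP[xc /eqP->]; rewrite ?mem_prev ?mem_next xc /=.
  by rewrite next_prev.
by rewrite prev_next.
Qed.

Lemma walk_step c a q b : path (next_rel c) a (rcons q b) -> walk (next_rel c) (next c a) (rcons q b) b.
Proof.
case: q => [|h q] /=; first by rewrite andbT => /andP[_ /eqP->]; rewrite !eqxx.
by case/andP=> /andP[_ /eqP<-] ->; rewrite last_rcons !eqxx.
Qed.

(** Each arc starts just after one of the two vertices and ends at the other, the form in which the
    reroutings use it. The arcs of [rot_to_arc] start at the vertices themselves, hence the extra
    [rot 1]. *)
Lemma split_two c a b : uniq c -> a \in c -> b \in c -> a != b ->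
  exists i A B, [/\ rot 1 (rot i c) = A ++ B, walk (next_rel c) (next c a) A b & walk (next_rel c) (next c b) B a].
Proof.
move=> uc ac bc ab.
have [i q1 q2 _ _ E] := rot_to_arc uc ac bc ab.
have : path (next_rel c) a (rcons q1 b ++ rcons q2 a).
  rewrite cat_rcons -rcons_cons -rcons_cat.
  rewrite -[path _ _ _]/(cycle (next_rel c) (a :: q1 ++ b :: q2)) -E.
  by rewrite -(eq_cycle (next_rel_rot i uc)) next_rel_cycle // rot_uniq.
rewrite cat_path last_rcons => /andP[/walk_step h1 /walk_step h2].
exists i, (rcons q1 b), (rcons q2 a); split=> //.
by rewrite E rot1_cons cat_rcons -rcons_cons rcons_cat.
Qed.

Lemma next_neq_prev c x : uniq c -> x \in c -> 2 < size c -> next c x != prev c x.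
Proof.
move=> uc xc sc; apply/eqP => np.
have nn : next c (next c x) = x by rewrite np next_prev.
have [i s E] := rot_to xc.
have ur : uniq (x :: s) by rewrite -E rot_uniq.
move: nn sc; rewrite -!(next_rot i uc) -(size_rot i) E.
case: s ur {E} => [|y [|w s]] //= ur; rewrite !eqxx.
move: ur; rewrite !inE !negb_or -!andbA => /and3P[xy xw _].
by rewrite eq_sym (negbTE xy) => wx; rewrite wx eqxx in xw.
Qed.
End Lists.

Ltac perm_tac := clear; apply/permP=> ?; rewrite -?cats1 ?(count_cat, count_rev) /= ?(count_cat, count_rev) /=; lia.

(** * Longest cycles through a vertex *)

Definition longest (T : eqType) (f : rel T) (v : T) (c : seq T) : Prop :=
  [/\ uniq c, cycle f c, v \in c &
      forall c', uniq c' -> cycle f c' -> v \in c' -> size c' <= size c].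

Section Longest.
Variables (T : eqType) (f : rel T) (v : T).
Hypothesis fs : symmetric f.
Implicit Types (c s A : seq T) (P : {pred T}).

(** Common form of the reroutings: the new cycle loses [m] and gains [s], so only these two lists
    have to be compared in length. *)
Lemma longest_contra c c' m s : longest f v c -> cycle f c' ->
  perm_eq (m ++ c') (c ++ s) -> uniq (c ++ s) -> v \notin m ->
  size m < size s -> False.
Proof.
case=> uc cc vc mx cc' pe us vm sz.
have um : uniq (m ++ c') by rewrite (perm_uniq pe).
have vc' : v \in c'.
  have : v \in m ++ c' by rewrite (perm_mem pe) mem_cat vc.
  by rewrite mem_cat (negbTE vm).
have uc' : uniq c' by move: um; rewrite cat_uniq => /and3P[].
have := mx _ uc' cc' vc'; have := perm_size pe; rewrite !size_cat => E h; clear -E h sz; lia.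
Qed.

Lemma longest_rot c i : longest f v c -> longest f v (rot i c).
Proof.
case=> uc cc vc mx; split; rewrite ?rot_uniq ?rot_cycle ?mem_rot // size_rot //.
Qed.

Lemma longest_rev c : longest f v c -> longest f v (rev c).
Proof.
case=> uc cc vc mx; split; rewrite ?rev_uniq ?mem_rev ?size_rev //.
by rewrite rev_cycle (eq_cycle (e' := f)) // => x y; rewrite fs.
Qed.

Definition linked P := forall x y, x \in P -> y \in P ->
  exists s, [/\ walk f x s y, uniq s & {subset s <= P}].

Lemma uniq_cat_out c s P : uniq c -> uniq s -> {subset s <= P} ->
  (forall x, x \in P -> x \notin c) -> uniq (c ++ s).
Proof.
move=> uc us sP Pc; rewrite cat_uniq uc us andbT /=.
by apply/hasPn => x /sP/Pc.
Qed.

(** * Rerouting through a component attached at two vertices of the cycle *)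

Section Arc.
Variables (A1 A2 : seq T) (p1 a2 p2 a1 : T) (K : {pred T}).
Hypotheses (lc : longest f v (A1 ++ A2)) (hA1 : walk f p1 A1 a2) (hA2 : walk f p2 A2 a1)
  (a1p1 : f a1 p1) (Kout : forall x, x \in K -> x \notin A1 ++ A2) (Kl : linked K).

Let cuniq : uniq (A1 ++ A2). Proof. by case: lc. Qed.

(** Here [p1], [p2] are the successors of the attachments [a1], [a2]. Each pattern that
    [triple_count] forbids would yield a longer cycle through [K]. *)
Lemma arc_bound w1 w2 w : irreflexive f -> w1 \in K -> w2 \in K -> w \in K ->
  f a1 w1 -> f a2 w2 -> w != w1 ->
  count (f p1) A1 + count (f p2) A1 + count (f w) A1 <= (size A1).+1 + count_mem v A1.
Proof.
move=> fi w1K w2K wK aw1 aw2 ww1.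
have [t EA] := walk_ne hA1.
rewrite EA /= fi add0n.
have : count (f p1) t + count (f p2) (p1 :: t) + count (f w) (p1 :: t)
    <= (size t).+2 + count_mem v t.
  apply: triple_count => [s1 x y s2 E|s1 x m y s2 E mv]; rewrite -EA in E.
    have [h1 xy h2] : [/\ walk f p1 (rcons s1 x) x, f x y & walk f y (y :: s2) a2].
      by apply: walk_cat_inv; rewrite cat_rcons -E.
    split; apply/negP => /andP[H1 H2].
      (* Cycle: [x] back to [p1], [y] on to [a2], through [K] to [a1], back along [A2] to [p2], then
         [x]. *)
      have [s [ps us sK]] := Kl w2K w1K.
      apply: (longest_contra (c' := rev (rcons s1 x) ++ (y :: s2) ++ s ++ rev A2)
         (m := [::]) lc _ _ (uniq_cat_out cuniq us sK Kout)) => //.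
      + apply: (walk_cycle (a := x) (b := p2)) => //.
        apply: (walk_cat (walk_rev fs h1) H1).
        apply: (walk_cat h2 aw2); apply: (walk_cat ps) (walk_rev fs hA2).
        by rewrite fs.
      + by rewrite E; perm_tac.
      + by case: (walk_ne ps) => s' ->.
    (* Cycle: [p1] to [x], through [K] from [w] to [w2], [a2] back to [y], [p2] on to [a1], then
       [p1]. *)
    have [s [ps us sK]] := Kl wK w2K.
    apply: (longest_contra (c' := rcons s1 x ++ s ++ rev (y :: s2) ++ A2)
         (m := [::]) lc _ _ (uniq_cat_out cuniq us sK Kout)) => //.
    + apply: (walk_cycle (a := p1) (b := a1)) => //.
      apply: (walk_cat h1); first by rewrite fs; exact: H1.
      apply: (walk_cat ps); first by rewrite fs; exact: aw2.
      by apply: (walk_cat (walk_rev fs h2)) hA2; rewrite fs.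
    + by rewrite E; perm_tac.
    + by case: (walk_ne ps) => s' ->.
  have [h1 xm h2] : [/\ walk f p1 (rcons s1 x) x, f x m & walk f m (m :: y :: s2) a2].
    by apply: walk_cat_inv; rewrite cat_rcons -E.
  have [_ my h3] : [/\ walk f m (rcons [::] m) m, f m y & walk f y (y :: s2) a2].
    exact: (@walk_cat_inv _ f m [::] m y s2 a2 h2).
  apply/negP => /andP[H1 H2].
  (* Cycle: [y] to [a2], [p2] to [a1], through [K] from [w1] to [w], [x] back to [p1], then [y]. It
     skips [m], but [w != w1] makes the detour gain at least two vertices. *)
  have [s [ps us sK]] := Kl w1K wK.
  apply: (longest_contra (c' := (y :: s2) ++ A2 ++ s ++ rev (rcons s1 x))
       (m := [:: m]) lc _ _ (uniq_cat_out cuniq us sK Kout)) => //.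
  + apply: (walk_cycle (a := y) (b := p1)) => //.
    have a2p2 : f a2 p2.
      case: lc => _; rewrite EA /= rcons_path cat_path last_cat.
      have [t2 ->] := walk_ne hA2; case/andP=> /andP[_ /= /andP[+ _]] _ _ _.
      by move: hA1; rewrite EA => /and3P[_ _ /eqP->].
    apply: (walk_cat h3 a2p2).
    apply: (walk_cat hA2 aw1).
    by apply: (walk_cat ps) (walk_rev fs h1).
  + by rewrite E; perm_tac.
  + by rewrite inE eq_sym.
  + have [s' Es] := walk_ne ps.
    case: s' Es ps => [->|? ? -> //] /and3P[_ _ /eqP /= E1].
    by rewrite E1 eqxx in ww1.
by move=> H; apply: leq_trans H _; rewrite /= leq_add2l leq_addl.
Qed.

(** Otherwise a path of [K] could be inserted between [a1] and [p1]. *)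
Lemma arc_succ w1 w : w1 \in K -> w \in K -> f a1 w1 -> ~~ f p1 w.
Proof.
move=> w1K wK aw1; apply/negP => pw.
have [s [ps us sK]] := Kl w1K wK.
apply: (longest_contra (c' := A1 ++ A2 ++ s)
   (m := [::]) lc _ _ (uniq_cat_out cuniq us sK Kout)) => //.
+ apply: (walk_cycle (a := p1) (b := w)); last by rewrite fs.
  apply: (walk_cat hA1 _ (walk_cat hA2 aw1 ps)).
  have [t1 E1] := walk_ne hA1; have [t2 E2] := walk_ne hA2.
  case: lc => _; rewrite E1 E2 /= rcons_path cat_path /= -!andbA => /and3P[_ + _] _ _.
  by move: hA1; rewrite E1 => /and3P[_ _ /eqP->].
+ by perm_tac.
+ by case: (walk_ne ps) => s' ->.
Qed.

(** Otherwise [r] joins [p1] to [p2] while [K] joins [a1] to [a2], and the cycle gains [r] and a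
    path of [K]. *)
Lemma arc_common w1 w2 r : w1 \in K -> w2 \in K -> f a1 w1 -> f a2 w2 ->
  r \notin K -> r \notin A1 ++ A2 -> ~~ (f p1 r && f p2 r).
Proof.
move=> w1K w2K aw1 aw2 rK rA; apply/negP => /andP[pr1 pr2].
have [s [ps us sK]] := Kl w2K w1K.
have rs : r \notin s by apply/negP => /sK; rewrite (negbTE rK).
apply: (longest_contra (c' := [:: r] ++ A1 ++ s ++ rev A2)
   (m := [::]) (s := r :: s) lc) => //.
+ apply: (walk_cycle (a := r) (b := p2)) => //.
  apply: (walk_cat (walk1 f r)); first by rewrite fs; exact: pr1.
  apply: (walk_cat hA1 aw2).
  by apply: (walk_cat ps) (walk_rev fs hA2); rewrite fs.
+ by perm_tac.
+ rewrite cat_uniq cuniq /= negb_or rA rs us /= andbT.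
  by apply/hasPn => x /sK/Kout.
Qed.

End Arc.
End Longest.

(** * The complement of a longest cycle is independent *)

Definition thin (T : eqType) (e : rel T) (u v z : T) : rel T :=
  fun x y => [&& e x y, (x == v) ==> (y \in [:: u; z]) & (y == v) ==> (x \in [:: u; z])].

Lemma card_count (T : finType) (P : pred T) (c : seq T) : uniq c ->
  #|[set x | P x]| = count P c + #|[set x | P x & x \notin c]|.
Proof.
move=> uc; rewrite -(cardsID [set x in c]); congr (_ + _).
  rewrite -size_filter -(card_uniqP (filter_uniq P uc)).
  by apply: eq_card => x; rewrite !inE mem_filter.
by apply: eq_card => x; rewrite !inE andbC.
Qed.

Lemma connect_closed (T : finType) (r : rel T) (P : pred T) x y :
  connect r x y -> P x -> (forall a b, P a -> r a b -> P b) -> P y.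
Proof.
move=> /connectP[p + ->] + H; elim: p x => //= a p IH x /andP[rxa pp] Px.
exact: IH pp (H _ _ Px rxa).
Qed.

Section Stage1.
Variables (T : finType) (e : rel T) (k : nat) (u v z : T).
Hypotheses (es : symmetric e) (ei : irreflexive e) (ereg : regular e k).
Hypothesis uvz : uniq [:: u; v; z].
Let f := thin e u v z.

Lemma thin_sym : symmetric f.
Proof. by move=> x y; rewrite /f /thin es; case: (e y x) => //=; rewrite andbC. Qed.

Lemma thin_irr : irreflexive f.
Proof. by move=> x; rewrite /f /thin ei. Qed.

Lemma thin_sub x y : f x y -> e x y.
Proof. by case/and3P. Qed.

Lemma thin_off x y : x != v -> y != v -> f x y = e x y.
Proof. by move=> /negbTE xv /negbTE yv; rewrite /f /thin xv yv /= !andbT. Qed.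

Lemma thin_v x : f v x -> x \in [:: u; z].
Proof. by case/and3P => _; rewrite eqxx. Qed.

(** The only edge at [x] that thinning can remove is the one to [v]. *)
Lemma thin_deg x : x != v -> k <= #|[set y | f x y]|.+1.
Proof.
move=> xv; rewrite -(ereg x).
apply: (leq_trans (n := #|v |: [set y | f x y]|)); last by rewrite cardsU1; case: (v \notin _).
apply: subset_leq_card; apply/subsetP => y; rewrite !inE.
by case: (eqVneq y v) => //= yv; rewrite thin_off.
Qed.

Section Core.
Variables (c : seq T) (K : {pred T}).
Hypotheses (hn : #|T| <= 3 * k - 6) (k4 : 3 < k) (lc : longest f v c).
Hypotheses (Kout : forall x, x \in K -> x \notin c) (Kl : linked f K)
  (Kcl : forall x y, x \in K -> y \notin c -> e x y -> y \in K).

(** The two arc bounds add up to at most |c| + 3 neighbours on the cycle; off it there are at most n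
    - |c| - 1. The total n + 2 is below 3(k - 1), which [thin_deg] requires. *)
Lemma core_contra a1 a2 w1 w2 w : a1 \in c -> a2 \in c -> a1 != a2 ->
  next c a1 != v -> next c a2 != v -> w1 \in K -> w2 \in K -> w \in K ->
  f a1 w1 -> f a2 w2 -> w != w1 -> w != w2 -> False.
Proof.
move=> a1c a2c a12 n1 n2 w1K w2K wK aw1 aw2 ww1 ww2.
have [uc cc vc _] := lc.
have [i [A1 [A2 [E h1 h2]]]] := split_two uc a1c a2c a12.
have lr : longest f v (A1 ++ A2) by rewrite -E; do 2!apply: longest_rot.
have lr' : longest f v (A2 ++ A1) by rewrite -rot_size_cat; apply: longest_rot.
have mr x : (x \in A1 ++ A2) = (x \in c) by rewrite -E !mem_rot.
have mr' x : (x \in A2 ++ A1) = (x \in c) by rewrite mem_cat orbC -mem_cat mr.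
have sr : size A1 + size A2 = size c by rewrite -size_cat -E !size_rot.
have cr P : count P A1 + count P A2 = count P c.
  by rewrite -count_cat -E; apply/permP; rewrite perm_rot perm_rot.
have Ko x : x \in K -> x \notin A1 ++ A2 by rewrite mr; apply: Kout.
have Ko' x : x \in K -> x \notin A2 ++ A1 by rewrite mr'; apply: Kout.
have cf : subrel (next_rel c) f by move=> x y; apply: next_rel_sub.
have {}h1 := sub_walk cf h1; have {}h2 := sub_walk cf h2.
set p1 := next c a1 in n1 h1; set p2 := next c a2 in n2 h2.
have a1p1 : f a1 p1 by apply: next_cycle.
have a2p2 : f a2 p2 by apply: next_cycle.
have fs := thin_sym; have fi := thin_irr.
have b1 := arc_bound fs lr h1 h2 a1p1 Ko Kl fi w1K w2K wK aw1 aw2 ww1.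
have b2 := arc_bound fs lr' h2 h1 a2p2 Ko' Kl fi w2K w1K wK aw2 aw1 ww2.
have s1 x : x \in K -> ~~ f p1 x by move=> xK; apply: (arc_succ fs lr h1 h2 Ko Kl w1K xK aw1).
have s2 x : x \in K -> ~~ f p2 x by move=> xK; apply: (arc_succ fs lr' h2 h1 Ko' Kl w2K xK aw2).
have s3 x : x \notin K -> x \notin c -> ~~ (f p1 x && f p2 x).
  by move=> xK xc; apply: (arc_common fs lr h1 h2 Ko Kl w1K w2K aw1 aw2 xK); rewrite mr.
have wv : w != v by apply: contraTneq wK => ->; apply: contraTN vc; apply: Kout.
pose R x := [set y | f x y & y \notin c].
have dR x : #|[set y | f x y]| = count (f x) c + #|R x| by apply: card_count.
(* Off the cycle, [p1] and [p2] see nothing of [K] and share nothing outside it, whereas [w] sees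
   only [K]. The three sets are disjoint, and all of them miss [w]. *)
have cR : #|R p1| + #|R p2| + #|R w| + size c < #|T|.
  have d12 : #|R p1 :|: R p2| = #|R p1| + #|R p2|.
    rewrite cardsU (_ : _ :&: _ = set0) ?cards0 ?subn0 //.
    apply/setP => x; rewrite !inE; case: (boolP (x \in K)) => [/s1/negbTE->//|xK].
    by case: (boolP (x \in c)) => xc; rewrite ?andbF // !andbT (negbTE (s3 _ xK xc)).
  have d123 : #|(R p1 :|: R p2) :|: R w| = #|R p1| + #|R p2| + #|R w|.
    rewrite cardsU d12 (_ : _ :&: _ = set0) ?cards0 ?subn0 //.
    apply/setP => x; rewrite !inE; case: (boolP (x \in K)) => xK.
      by rewrite (negbTE (s1 _ xK)) (negbTE (s2 _ xK)).
    case: (boolP (x \in c)) => xc; rewrite ?andbF ?andbT //=.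
    apply/negbTE/negP => /andP[_ fwx]; case/negP: xK.
    exact: Kcl wK xc (thin_sub fwx).
  rewrite -d123 -(card_uniqP uc) -(cardsE (mem c)) -(cardsC [set x in c]) addnC ltn_add2l.
  apply: proper_card; apply/properP; split.
    apply/subsetP => x; rewrite !inE.
    by case: (x \in c); rewrite ?andbF.
  exists w; rewrite !inE; first exact: Kout.
  by rewrite fi (negbTE (s1 _ wK)) (negbTE (s2 _ wK)).
have D1 := thin_deg n1; have D2 := thin_deg n2; have D3 := thin_deg wv.
rewrite -!/f !dR -!cr in D1 D2 D3.
have cv : count_mem v A1 + count_mem v A2 = 1 by rewrite cr count_uniq_mem // vc.
clear - hn k4 b1 b2 sr cR D1 D2 D3 cv; lia.
Qed.
End Core.

Hypotheses (conn : k_connected e 3) (euv : e u v) (evz : e v z)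
  (connP : connected_minus e [set u; v; z]) (hn : #|T| <= 3 * k - 6).

Lemma k_gt3 : 3 < k.
Proof.
have [n3 _] := conn.
have kn : k < #|T|.
  rewrite -(ereg v) -cardsT; apply: proper_card; apply/properP; split; first exact: subsetT.
  by exists v; rewrite !inE ?ei.
by clear - n3 kn hn; lia.
Qed.

Lemma uvz_neq : [/\ u != v, z != v & u != z].
Proof. by move: uvz; rewrite /= !inE !negb_or => /andP[/andP[-> ->] /andP[]]; rewrite eq_sym => ->. Qed.

Lemma nbrs_v c : longest f v c -> 2 < size c ->
  [\/ next c v = u /\ prev c v = z | next c v = z /\ prev c v = u].
Proof.
move=> [uc cc vc _] sc.
have nv := thin_v (next_cycle cc vc).
have pv : prev c v \in [:: u; z] by apply: thin_v; rewrite thin_sym; apply: prev_cycle.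
have := next_neq_prev uc vc sc.
by move: nv pv; rewrite !inE => /pred2P[]-> /pred2P[]->; rewrite ?eqxx //; [left|right].
Qed.

(** [K] is the component of [x] in the graph without [c]. Two attachments with neighbours [w1], [w2]
    in [K], possibly equal, and a further vertex [w] of [K] contradict [core_contra]; the
    connectivity hypotheses provide them. *)
Lemma longest_outside c x y : longest f v c -> 2 < size c ->
  x \notin c -> y \notin c -> ~~ e x y.
Proof.
move=> lc sc xc yc; apply/negP => exy.
have [uc cc vc mc] := lc; have [uv zv uz] := uvz_neq; have k4 := k_gt3.
have [uC zC] : u \in c /\ z \in c.
  by case: (nbrs_v lc sc) => -[<- <-]; rewrite mem_next mem_prev.
pose g := induced_rel e (~: [set a in c]).
pose K : {set T} := [set w | connect g x w].
have gs : symmetric g by move=> a b; rewrite /g /induced_rel es; do !case: (_ \in _).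
have xK : x \in K by rewrite inE connect0.
have Kcl a b : a \in K -> b \notin c -> e a b -> b \in K.
  rewrite !inE => xa bc eab; apply: connect_trans (xa) _.
  have ac : a \notin c.
    by apply: (connect_closed (P := fun w => w \notin c) xa) => // p q _ /and3P[_ + _]; rewrite !inE.
  by apply: connect1; rewrite /g /induced_rel !inE ac bc.
have Kout a : a \in K -> a \notin c.
  rewrite inE => xa.
  by apply: (connect_closed (P := fun w => w \notin c) xa) => // p q _ /and3P[_ + _]; rewrite !inE.
have yK : y \in K by apply: Kcl exy.
have Kl : linked f (mem K).
  move=> a b aK bK; have : connect g a b.
    move: aK bK; rewrite !inE => xa; apply: connect_trans.
    by rewrite sym_connect_sym.
  move=> /connectP[p0 pp ->]; case: (shortenP pp) => p pp' up _.
  exists (a :: p); split=> //.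
  + rewrite /= !eqxx andbT /=; apply: sub_path pp' => i j /and3P[].
    rewrite !inE => ic jc; rewrite thin_off //; first by apply: contraNneq ic => ->.
    by apply: contraNneq jc => ->.
  + move=> w /(path_connect pp'); rewrite !inE => aw.
    by move: aK; rewrite inE => /connect_trans; apply.
pose att : {set T} := [set a | (a \in c) && [exists w in K, f a w]].
have attP a w : a \in c -> a != v -> w \in K -> e a w -> a \in att.
  move=> ac av wK eaw; rewrite inE ac; apply/existsP; exists w; rewrite wK thin_off //.
  by apply: contraNneq (Kout _ wK) => ->.
(* If deleting [S] leaves the graph connected, [K] reaches [b] and therefore attaches outside [S].
   The set contains [v] because attachments are taken in [f], which agrees with [e] off [v]. *)
have sep (S : {set T}) b : v \in S -> b \in c -> b \notin S -> S \subset [set w in c] ->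
    connected_minus e S -> exists2 a, a \in att & a \notin S.
  move=> vS bc bS Sc cS; case: (pickP [pred a in att | a \notin S]) => [a /andP[]|no]; first by exists a.
  have xS : x \notin S by apply: contraNN xc => /(subsetP Sc); rewrite inE.
  have xb : connect (induced_rel e (~: S)) x b by apply: cS; rewrite inE.
  have : b \in K.
    apply: (connect_closed xb xK) => p q pK /and3P[_]; rewrite inE => qS epq.
    case: (boolP (q \in c)) => qc; last exact: Kcl epq.
    have := no q; rewrite inE /= qS andbT (attP q p) // 1?es //.
    by apply: contraNneq qS => ->.
  by move=> /Kout; rewrite bc.
have att2 b : b \in c -> exists2 a, a \in att & a != b.
  move=> bc; have : ~~ all (mem [:: b; v]) c.
    by apply/negP => /allP /(uniq_leq_size uc) /=; rewrite leqNgt sc.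
  case/allPn => d dc; rewrite !inE negb_or => /andP[db dv].
  case: (sep [set b; v] d) => //; rewrite ?inE ?eqxx ?orbT ?negb_or ?db ?dv //.
  + by apply/subsetP => w; rewrite !inE => /pred2P[]->.
  + by case: conn => _; apply; rewrite cards2; case: (b != v).
  + by move=> a aatt; rewrite !inE negb_or => /andP[ab _]; exists a.
(* For an attachment other than [u] and [z], the vertex [v] is neither successor nor predecessor, so
   the cycle may still be traversed in either direction. *)
have [a aatt auz] : exists2 a, a \in att & a \notin [:: u; z].
  case: (boolP (all (mem [:: u; v; z]) c)) => [/allP cuvz|/allPn[d dc]].
    case: (boolP [exists a in att, a \notin [:: u; z]]) => [/exists_inP //|/exists_inPn no].
    (* Here [c] has only the vertices [u], [v], [z]; attachments at both [u] and [z] give the longer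
       cycle from [v] through [u], [K] and [z]. *)
    have s3 : size c <= 3 by apply: (uniq_leq_size uc cuvz).
    have [a aatt au] := att2 _ uC; have [b batt bz] := att2 _ zC.
    have az : a = z by have := no _ aatt; rewrite !inE negbK (negbTE au) => /eqP.
    have bu : b = u by have := no _ batt; rewrite !inE negbK (negbTE bz) orbF => /eqP.
    move: aatt batt; rewrite az bu !inE zC uC /= => /exists_inP[w1 w1K zw1] /exists_inP[w2 w2K uw2].
    have [s [ps us sK]] := Kl _ _ w2K w1K.
    have : size ([:: v; u] ++ s ++ [:: z]) <= size c.
      apply: mc; last by rewrite mem_head.
        have -> : uniq ([:: v; u] ++ s ++ [:: z]) = uniq ([:: v; u; z] ++ s).
          by apply: perm_uniq; perm_tac.
        apply: (uniq_cat_out (P := mem K)) => //; first by rewrite /= !inE negb_or andbT uz andbT; apply/andP; split; rewrite eq_sym.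
        move=> w /Kout; apply: contra; rewrite !inE => /or3P[]/eqP-> //.
      have fuv : f u v by rewrite /f /thin euv !inE !eqxx (negbTE uv).
      have fvz : f v z by rewrite /f /thin evz !inE !eqxx (negbTE zv) orbT.
      apply: (walk_cycle (a := v) (b := z)); last by rewrite thin_sym.
      apply: (walk_cat (b := u)) uw2 _; first by rewrite /= !eqxx /= !andbT thin_sym.
      by apply: (walk_cat ps) (walk1 _ _); rewrite thin_sym.
    by have [s' ->] := walk_ne ps; rewrite /= size_cat /= addn1 => h1; have := leq_trans h1 s3.
  rewrite !inE !negb_or => /and3P[du dv dz].
  case: (sep [set u; v; z] d) => //; rewrite ?inE ?eqxx ?orbT ?negb_or ?du ?dv ?dz //.
  + by apply/subsetP => w; rewrite !inE -orbA => /or3P[]/eqP->.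
  + by move=> a aatt; rewrite !inE !negb_or => /andP[/andP[au _] az]; exists a; rewrite // !inE negb_or au.
have [ac [w1 w1K aw1]] : a \in c /\ exists2 w, w \in K & f a w.
  by move: aatt; rewrite inE => /andP[ac /exists_inP]; split.
suff [b [w2 [w [[bc ba w2K wK] [bw2 ww1 ww2]]]]] : exists b w2 w, [/\ b \in c, b != a, w2 \in K & w \in K] /\
    [/\ f b w2, w != w1 & w != w2].
  have nbV d : d \in c -> f d v -> d \in [:: u; z] by move=> _; rewrite thin_sym => /thin_v.
  have av : next c a != v.
    by apply: contraNneq auz => E; apply: nbV; rewrite // -E; apply: next_cycle.
  have av' : prev c a != v.
    by apply: contraNneq auz => E; apply: nbV; rewrite // -E thin_sym; apply: prev_cycle.
  rewrite eq_sym in ba.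
  (* If [v] follows [b], it does not precede [b], and the reversed cycle is used instead. *)
  case: (eqVneq (next c b) v) => bv; last exact: (core_contra hn k4 lc Kout Kl Kcl ac bc ba av bv w1K w2K wK).
  have bv' : prev c b != v by rewrite -bv eq_sym; apply: next_neq_prev.
  have Kout' d : d \in K -> d \notin rev c by rewrite mem_rev; apply: Kout.
  have Kcl' p q : p \in K -> q \notin rev c -> e p q -> q \in K by rewrite mem_rev; apply: Kcl.
  by apply: (core_contra (c := rev c) hn k4 (longest_rev thin_sym lc) Kout' Kl Kcl' _ _ ba _ _ w1K w2K wK);
    rewrite ?mem_rev ?next_rev.
have w1v : w1 != v by apply: contraNneq (Kout _ w1K) => ->.
(* If [w1] has a second neighbour [b] on the cycle, take [w2 := w1] and any other vertex of [K] for
   [w]. Otherwise all its neighbours except [a] lie in [K], so [K] has at least k - 2 vertices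
   besides [w1], enough to choose [w] apart from [w1] and [w2]. *)
case: (pickP [pred b in c | (b != a) && f w1 b]) => [b /and3P[bc ba w1b]|no].
  have [w wK ww1] : exists2 w, w \in K & w != w1.
    case: (eqVneq x w1) => [xw1|]; last by exists x.
    by exists y => //; apply: contraTneq exy => ->; rewrite xw1 ei.
  by exists b, w1, w; rewrite thin_sym.
have [b batt ba] := att2 _ ac.
move: batt; rewrite inE => /andP[bc /exists_inP[w2 w2K bw2]].
have : [set y | f w1 y] \subset a |: (K :\ w1).
  apply/subsetP => d; rewrite in_set => w1d; rewrite in_setU1 in_setD1.
  case: (boolP (d \in c)) => dc.
    by have := no d; rewrite inE /= dc w1d andbT => /negbFE->.
  rewrite (Kcl _ _ w1K dc (thin_sub w1d)) andbT; apply/orP; right.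
  by apply: contraTneq w1d => ->; rewrite thin_irr.
move=> /subset_leq_card; rewrite cardsU1 => h.
have h2 := thin_deg w1v; have h3 := cardsD1 w2 (K :\ w1).
have : 0 < #|(K :\ w1) :\ w2|.
  move: h h2 h3; rewrite -/f; case: (a \notin _); case: (w2 \in _) => /= h h2 h3; clear -h h2 h3 k4; lia.
case/card_gt0P => w; rewrite !inE => /and3P[ww2 ww1 wK].
by exists b, w2, w; split; split=> //; rewrite inE.
Qed.
End Stage1.

(** * Hopping *)

Section Hop.
Variables (T : finType) (f : rel T) (v v0 : T) (c : seq T).
Hypotheses (fs : symmetric f) (fi : irreflexive f) (lc : longest f v c)
  (sc : 2 < size c) (v0c : v0 \notin c).

Definition adj : rel T := fun x y => next_rel c x y || next_rel c y x.

Definition hopX (Y : {set T}) : {set T} := [set x | [exists y in v0 |: Y, f y x]].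
Definition hopY (Y : {set T}) : {set T} :=
  [set y in c | (y != v) && [forall x, adj y x ==> (x \in hopX Y)]].
Definition hopIter n := iter n hopY set0.
(* Edges usable by a path that still passes every vertex of Z between its two
   neighbours on c. *)
Definition keep (Z : {set T}) : rel T := fun x y => f x y && ((x \in Z) || (y \in Z) ==> adj x y).

Definition closable (D : seq T) := exists c', [/\ uniq c', cycle f c' & perm_eq c' (v0 :: D)].

Let uc : uniq c. Proof. by case: lc. Qed.
Let cc : cycle f c. Proof. by case: lc. Qed.

Lemma adj_sym : symmetric adj. Proof. by move=> x y; rewrite /adj orbC. Qed.

Lemma adj_next x : x \in c -> adj x (next c x).
Proof. by move=> xc; rewrite /adj /next_rel xc eqxx. Qed.

Lemma adj_prev x : x \in c -> adj x (prev c x).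
Proof. by move=> xc; rewrite /adj /next_rel mem_prev xc next_prev // eqxx orbT. Qed.

Lemma keep_sym Z : symmetric (keep Z).
Proof. by move=> x y; rewrite /keep fs adj_sym orbC. Qed.

Lemma keep_sub (Z Z' : {set T}) : Z' \subset Z -> subrel (keep Z) (keep Z').
Proof.
move=> /subsetP s x y /andP[fxy /implyP h]; rewrite /keep fxy; apply/implyP => xy; apply: h.
by case/orP: xy => /s ->; rewrite ?orbT.
Qed.

Lemma keep_f Z : subrel (keep Z) f. Proof. by move=> x y /andP[]. Qed.

Lemma next_rel_keep Z : subrel (next_rel c) (keep Z).
Proof. by move=> x y xy; rewrite /keep (next_rel_sub cc xy) /adj xy /= implybT. Qed.

Lemma keep_new (Z : {set T}) x y : x \notin Z -> y \notin Z -> f x y -> keep Z x y.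
Proof. by rewrite /keep => /negbTE-> /negbTE-> ->. Qed.

Lemma hopXS (Y Y' : {set T}) : Y \subset Y' -> hopX Y \subset hopX Y'.
Proof.
move=> YY; apply/subsetP => x; rewrite !inE => /exists_inP[y yY fyx].
by apply/exists_inP; exists y => //; apply: subsetP yY; apply: setUS.
Qed.

Lemma hopYS (Y Y' : {set T}) : Y \subset Y' -> hopY Y \subset hopY Y'.
Proof.
move=> YY; apply/subsetP => x; rewrite !inE => /and3P[-> -> /forallP h] /=.
apply/forallP => y; apply/implyP => xy; apply: subsetP (hopXS YY) _ _.
by have := h y; rewrite xy.
Qed.

Lemma hopIterS n : hopIter n \subset hopIter n.+1.
Proof. by elim: n => [|n IH]; [apply: sub0set | apply: hopYS]. Qed.

Lemma hopIterP n y x : y \in hopIter n.+1 -> adj y x -> x \in hopX (hopIter n).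
Proof. by rewrite -[hopIter n.+1]/(hopY (hopIter n)) in_set => /and3P[_ _ /forallP/(_ x)/implyP]; apply. Qed.

Lemma hopIter_c n y : y \in hopIter n -> y \in c.
Proof. by case: n => [|n]; rewrite inE // => /and3P[]. Qed.

Lemma hopX_new n x : x \in hopX (hopIter n.+1) -> x \in hopX (hopIter n) \/
  exists y, [/\ y \in hopIter n.+1, y \notin hopIter n & f y x].
Proof.
rewrite inE => /exists_inP[y]; rewrite in_setU1 => yY fyx.
case: (boolP (x \in hopX (hopIter n))) => [|xX]; [by left | right].
have : y \notin v0 |: hopIter n.
  by apply: contra xX => yY'; rewrite inE; apply/exists_inP; exists y.
rewrite in_setU1 negb_or => /andP[yv0 yn]; rewrite (negbTE yv0) /= in yY.
by exists y.
Qed.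

Definition spread n := forall x y, adj x y -> x \in hopX (hopIter n) -> y \notin hopX (hopIter n).

(** Each protected [y] stands on the path between its cycle neighbours. A hop can thus break the
    path at [y] and make one of these neighbours the new end, which lies in an earlier X. *)
Definition hops n := forall D a b, walk (keep (hopIter n)) a D b -> uniq D ->
  {subset hopIter n <= D} -> a != b -> a \in hopX (hopIter n) -> b \in hopX (hopIter n) ->
  a \notin hopIter n -> b \notin hopIter n -> v0 \notin D -> closable D.

Lemma closable_perm D D' : perm_eq D D' -> closable D -> closable D'.
Proof.
move=> pD [c' [uc' cc' pc']]; exists c'; split=> //.
by apply: perm_trans pc' _; rewrite perm_cons.
Qed.

Lemma spreadY n y : spread n -> y \in hopIter n.+1 -> y \notin hopX (hopIter n).
Proof.
move=> P yY; have yc := hopIter_c yY.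
by apply: P (hopIterP yY (adj_next yc)); rewrite adj_sym adj_next.
Qed.

Lemma inner_split (r : rel T) a D b y : walk r a D b -> y \in D -> y != a ->
  exists p x q, [/\ D = rcons p x ++ y :: q, walk r a (rcons p x) x, r x y & walk r y (y :: q) b].
Proof.
move=> pD yD; have [p1 [q E]] : exists p1 q, D = p1 ++ y :: q.
  by case/splitPr: yD => p1 p2; exists p1, p2.
move: pD; rewrite {D yD}E; case: (lastP p1) => [/= /and3P[->]//|p x] pD _.
by exists p, x, q; case: (walk_cat_inv pD).
Qed.

(* The end a is adjacent to y, so the initial part of the path up to y can be
   reversed; this trades a for a neighbour of y on c, at the cost of y. *)
Lemma rotate_end (Z : {set T}) D a b y : walk (keep Z) a D b -> uniq D -> y \in Z -> y \in D ->
  a \notin Z -> b \notin Z -> f a y ->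
  exists D' x, [/\ walk (keep (Z :\ y)) x D' b, perm_eq D D', adj x y & x != b].
Proof.
move=> pD uD yZ yD aZ bZ fay.
have ya : y != a by apply: contraTneq yZ => ->.
have yb : y != b by apply: contraTneq yZ => ->.
have [p [x [q [E h1 xy h2]]]] := inner_split pD yD ya.
have ks := keep_sub (subD1set Z y).
exists (rev (rcons p x) ++ y :: q), x; split.
- apply: (walk_cat (walk_rev (keep_sym _) (sub_walk ks h1)) _ (sub_walk ks h2)).
  apply: keep_new => //; rewrite !inE ?eqxx //.
  by rewrite negb_and aZ orbT.
- by rewrite E; perm_tac.
- by case/andP: xy => _; rewrite yZ orbT.
- move: uD; rewrite E cat_uniq => /and3P[_ /hasPn h _].
  have : b \in y :: q by case: (walk_mem h2).
  by move/h; apply: contraNneq => <-; rewrite mem_rcons mem_head.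
Qed.

Section Step.
Variable n : nat.
Hypotheses (Hn : hops n) (Pn : spread n).
Let YXn y : y \in hopIter n -> y \notin hopX (hopIter n).
Proof. by move=> /(subsetP (hopIterS n)) /(spreadY Pn). Qed.

(** Rotating the new end [a] away leaves both ends in the previous X; only [y] loses its protection,
    and it is not among the previous Y. [Z] is kept general because a path with two new ends arrives
    here with one vertex already given up. *)
Lemma hops_half (Z : {set T}) a D b y : hopIter n \subset Z -> Z \subset hopIter n.+1 ->
  walk (keep Z) a D b -> uniq D -> {subset Z <= D} -> a \notin Z -> b \notin Z -> v0 \notin D ->
  y \in Z -> y \notin hopIter n -> f a y -> b \in hopX (hopIter n) -> closable D.
Proof.
move=> YZ ZY pD uD ZD aZ bZ vD yZ yn fay bX.
have [D' [x [pD' DD' xy xb]]] := rotate_end pD uD yZ (ZD _ yZ) aZ bZ fay.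
have xX : x \in hopX (hopIter n) by apply: (hopIterP (subsetP ZY _ yZ)); rewrite adj_sym.
have YZy : hopIter n \subset Z :\ y by rewrite subsetD1 YZ yn.
apply: (closable_perm (D := D')); first by rewrite perm_sym.
apply: (Hn (sub_walk (keep_sub YZy) pD')) => //.
- by rewrite -(perm_uniq DD').
- by move=> w /(subsetP YZ)/ZD; rewrite (perm_mem DD').
- by apply: contraTN xX => /YXn.
- by apply: contraTN bX => /YXn.
- by rewrite -(perm_mem DD').
Qed.

Lemma hopsS : hops n.+1.
Proof.
move=> D a b pD uD YD ab aX bX aY bY vD.
case: (hopX_new aX) => [aX'|[y [yY yn fay']]]; case: (hopX_new bX) => [bX'|[y' [y'Y y'n fby']]].
- apply: (Hn (sub_walk (keep_sub (hopIterS n)) pD)) => //.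
  + by move=> w /(subsetP (hopIterS n))/YD.
  + by apply: contra aY; apply: (subsetP (hopIterS n)).
  + by apply: contra bY; apply: (subsetP (hopIterS n)).
- apply: (closable_perm (D := rev D)); first by rewrite perm_rev.
  apply: (hops_half (hopIterS n) (subxx _) (walk_rev (keep_sym _) pD) _ _ bY aY _ y'Y y'n _ aX');
    rewrite ?rev_uniq ?mem_rev 1?fs //.
  by move=> w /YD; rewrite mem_rev.
- by apply: (hops_half (hopIterS n) (subxx _) pD uD YD aY bY vD yY yn _ bX'); rewrite fs.
have fay : f a y by rewrite fs.
have fby : f b y' by rewrite fs.
have ya : y != a by apply: contraTneq yY => ->.
have nosub w w' : w \in hopIter n.+1 -> w' \in hopIter n.+1 -> adj w w' -> False.
  by move=> wY w'Y ww'; have := spreadY Pn w'Y; rewrite (hopIterP wY ww').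
(* Both ends see the same [y], which stands between [x] and [w]. Running from [x] back to [a], over
   [y] to [b], and back to [w] makes these two cycle neighbours of [y] the ends. *)
case: (eqVneq y' y) => [yy|yy].
  rewrite {}yy in fby {y'Y y'n fby'}.
  have [p [x [q [E h1 xy h2]]]] := inner_split pD (YD _ yY) ya.
  have xadj : adj y x by rewrite adj_sym; case/andP: xy => _; rewrite yY orbT.
  have xX := hopIterP yY xadj.
  case: q E h2 => [|w q] E h2.
    by move: h2 => /and3P[_ _ /eqP yb]; rewrite /= in yb; rewrite -yb yY in bY.
  have [_ yw h3] := (@walk_cat_inv _ _ y [::] y w q b h2).
  have wadj : adj y w by case/andP: yw => _; rewrite yY.
  have wX := hopIterP yY wadj.
  have ks := keep_sub (hopIterS n).
  pose D' := rev (rcons p x) ++ [:: y] ++ rev (w :: q).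
  have DD' : perm_eq D D' by rewrite E /D'; perm_tac.
  have an : a \notin hopIter n by apply: contra aY; apply: (subsetP (hopIterS n)).
  have bn : b \notin hopIter n by apply: contra bY; apply: (subsetP (hopIterS n)).
  apply: (closable_perm (D := D')); first by rewrite perm_sym.
  apply: (Hn (a := x) (b := w)) => //; rewrite -?(perm_uniq DD') -?(perm_mem DD') //.
  + apply: (walk_cat (walk_rev (keep_sym _) (sub_walk ks h1)) (keep_new an yn fay)).
    apply: (walk_cat (walk1 _ y)) (walk_rev (keep_sym _) (sub_walk ks h3)).
    by apply: keep_new; rewrite // fs.
  + by move=> t /(subsetP (hopIterS n))/YD; rewrite (perm_mem DD').
  + move: uD; rewrite E cat_uniq => /and3P[_ /hasPn h _].
    have : w \in y :: w :: q by rewrite !inE eqxx orbT.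
    by move/h; apply: contraNneq => <-; rewrite mem_rcons mem_head.
  + by apply: contraTN xX => /YXn.
  + by apply: contraTN wX => /YXn.
(* Distinct [y] and [y']: one end is rotated at [y], then [hops_half] treats the other end with [y]
   removed from the protected set. *)
have [D' [x [pD' DD' xy xb]]] := rotate_end pD uD yY (YD _ yY) aY bY fay.
have xX : x \in hopX (hopIter n) by apply: (hopIterP yY); rewrite adj_sym.
have xY : x \notin hopIter n.+1 by apply/negP => xY; apply: nosub xY yY xy.
apply: (closable_perm (D := rev D')); first by rewrite perm_rev perm_sym.
apply: (hops_half (Z := hopIter n.+1 :\ y) (y := y')) (walk_rev (keep_sym _) pD') _ _ _ _ _ _ y'n fby xX.
- by rewrite subsetD1 hopIterS yn.
- exact: subD1set.
- by rewrite rev_uniq -(perm_uniq DD').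
- by move=> w; rewrite in_setD1 mem_rev => /andP[_ /YD]; rewrite (perm_mem DD').
- by rewrite in_setD1 negb_and bY orbT.
- by rewrite in_setD1 negb_and xY orbT.
- by rewrite mem_rev -(perm_mem DD').
- by rewrite in_setD1 yy.
Qed.
End Step.

Lemma closable_long D : closable D -> v \in D -> size D < size c.
Proof.
case: lc => _ _ _ mx [c' [uc' cc' pc']] vD.
by have := mx _ uc' cc'; rewrite (perm_mem pc') in_cons vD orbT (perm_size pc') => /(_ isT).
Qed.

Lemma cut x y : next_rel c x y -> exists i, walk (next_rel c) y (rot i c) x.
Proof.
case/andP=> xc /eqP yE.
have yc : y \in c by rewrite yE mem_next.
have [i s E] := rot_to yc; exists i; rewrite E.
have : cycle (next_rel c) (y :: s) by rewrite -E -(eq_cycle (next_rel_rot i uc)) next_rel_cycle // rot_uniq.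
move=> /cycle_walk[h /andP[lc' /eqP l]].
suff -> : x = last y s by [].
by apply: (can_inj (prev_next uc)); rewrite -l yE.
Qed.

Lemma hops0 : hops 0.
Proof.
have X0 x : x \in hopX (hopIter 0) -> f x v0.
  rewrite inE => /exists_inP[y]; rewrite !inE orbF => /eqP->.
  by rewrite fs.
move=> D a b pD uD _ ab /X0 fa /X0 fb _ _ vD.
exists (v0 :: D); split; rewrite //= ?vD //.
have fva : f v0 a by rewrite fs.
exact: walk_cycle (walk_cat (walk1 f v0) fva (sub_walk (@keep_f _) pD)) fb.
Qed.

(** If both ends of a cycle edge were in X, the cycle opened at that edge would close through [v0]
    to a longer one. *)
Lemma spread_step n : hops n -> (forall x, x \in hopX (hopIter n) -> x \notin hopIter n) -> spread n.
Proof.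
move=> Hn XY x y; wlog xy : x y / next_rel c x y.
  move=> H xy; case/orP: (xy) => [h|h]; first exact: H.
  by move=> xX; apply/negP => yX; rewrite adj_sym in xy;
    have := H _ _ h xy yX; rewrite xX.
move=> _ xX; apply/negP => yX.
have [i pD] := cut xy.
have [xc _] := andP xy.
have : closable (rot i c).
  apply: (Hn _ _ _ (sub_walk (next_rel_keep _) pD)); rewrite ?rot_uniq ?mem_rot //.
  - by move=> w /hopIter_c; rewrite mem_rot.
  - apply: contraTneq (next_rel_sub cc xy) => ->; by rewrite fi.
  - exact: XY.
  - exact: XY.
have [_ _ vc _] := lc.
by move/closable_long; rewrite mem_rot vc size_rot ltnn => /(_ isT).
Qed.

(** The point of the induction is that the new X and Y are disjoint. A common vertex [w] sees a new
    [y]; reversing an arc of the cycle along this edge gives a path between the successors of [w]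
    and [y], both in the previous X, and it would close through [v0]. *)
Lemma spread_hops n : spread n /\ hops n.
Proof.
elim: n => [|n [Pn Hn]].
  by split; [apply: spread_step hops0 _ => x _; rewrite inE | exact: hops0].
have HS := hopsS Hn Pn; split=> //; apply: spread_step HS _ => w wX; apply/negP => wY.
have wX' := spreadY Pn wY.
have Y1X y : y \in hopIter n -> y \notin hopX (hopIter n) by move=> /(subsetP (hopIterS n))/(spreadY Pn).
case: (hopX_new wX) => [|[y [yY yn fyw]]]; first exact/negP.
have wn : w \notin hopIter n.
  apply: contraL (spreadY Pn yY) => wY'; rewrite negbK.
  by rewrite inE; apply/exists_inP; exists w; rewrite ?inE ?wY' ?orbT // fs.
have wc := hopIter_c wY; have yc := hopIter_c yY.
have wy : w != y by apply: contraTneq fyw => ->; rewrite fi.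
have [i [A [B [E h1 h2]]]] := split_two uc wc yc wy.
have wX1 := hopIterP wY (adj_next wc); have yX1 := hopIterP yY (adj_next yc).
have : closable (A ++ rev B).
  apply: (Hn _ (next c w) (next c y)) => //.
  - apply: (walk_cat (sub_walk (next_rel_keep _) h1) (keep_new yn wn fyw)).
    by apply: walk_rev (keep_sym _) (sub_walk (next_rel_keep _) h2).
  - rewrite (perm_uniq (s2 := A ++ B)); last by perm_tac.
    by rewrite -E !rot_uniq.
  - by move=> t /hopIter_c; rewrite mem_cat mem_rev -mem_cat -E !mem_rot.
  - by rewrite (inj_eq (can_inj (prev_next uc))).
  - by apply: contraTN wX1 => /Y1X.
  - by apply: contraTN yX1 => /Y1X.
  - by rewrite mem_cat mem_rev -mem_cat -E !mem_rot.
have [_ _ vc _] := lc.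
move/closable_long; rewrite mem_cat mem_rev -mem_cat -E !mem_rot vc size_cat size_rev -size_cat -E !size_rot ltnn.
by move=> /(_ isT).
Qed.

Lemma hopY_fix : hopY (hopIter #|T|) = hopIter #|T|.
Proof. by apply: fixsetK => A B; apply: hopYS. Qed.

Hypothesis out : forall c' x y, longest f v c' -> size c <= size c' ->
  x \notin c' -> y \notin c' -> ~~ f x y.
Hypothesis adjv : forall y, f v y -> adj v y.

(** In [f] the vertex [v] sees only its cycle neighbours. [v0] is not one of them, and one in Y
    would already have put [v] into the previous X. *)
Lemma v_hopX n : v \notin hopX (hopIter n).
Proof.
have [_ _ vc _] := lc.
elim: n => [|n IH]; rewrite inE; apply/exists_inP => -[y]; rewrite in_setU1 => /orP[/eqP->|yY].
- by rewrite fs => /adjv; rewrite /adj /next_rel => /orP[] /andP[h /eqP E]; move: v0c; rewrite ?E ?mem_next ?h ?vc.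
- by rewrite inE in yY.
- by rewrite fs => /adjv; rewrite /adj /next_rel => /orP[] /andP[h /eqP E]; move: v0c; rewrite ?E ?mem_next ?h ?vc.
- by rewrite fs => /adjv; rewrite adj_sym => /(hopIterP yY); apply/negP.
Qed.

Lemma hopX_Y n x : x \in hopX (hopIter n) -> x \notin hopIter n.
Proof.
have [Pn _] := spread_hops n.
by apply: contraTN => /(subsetP (hopIterS n)) /(spreadY Pn).
Qed.

(* Otherwise y and v0 could be exchanged, and the new longest cycle would miss
   the edge from y to r. *)
Lemma exchange n y r : y \in hopIter n -> r \notin c -> ~~ f y r.
Proof.
elim: n => [|n IH] yY rc; first by rewrite inE in yY.
case: (boolP (y \in hopIter n)) => [yn|yn]; first exact: IH.
apply/negP => fyr; have yc := hopIter_c yY.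
have [Pn Hn] := spread_hops n.
have rv0 : r != v0.
  apply: contraNneq (spreadY Pn yY) => rv.
  by rewrite inE; apply/exists_inP; exists v0; rewrite ?inE ?eqxx // fs -rv.
have yv : y != v.
  by apply: contraTneq fyr => ->; apply/negP => /adjv /orP[] /andP[h /eqP E]; move: rc; rewrite ?E ?mem_next ?h.
have cy : next_rel c (prev c y) y by rewrite /next_rel mem_prev yc next_prev /=.
have [i] := cut cy.
have us : uniq (rot i c) by rewrite rot_uniq.
have ss : size (rot i c) = size c by rewrite size_rot.
have ms x : (x \in rot i c) = (x \in c) by rewrite mem_rot.
have [_ _ vc mx] := lc.
case: (rot i c) us ss ms => [//|y' [|w s]] us ss ms /and3P[/eqP E1]; first by have := sc; rewrite -ss.
rewrite /= => /andP[/andP[_ /eqP E2] ps] ls; rewrite {}E1 in us ms E2.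
have wX := hopIterP yY (adj_next yc); have pX := hopIterP yY (adj_prev yc).
have : closable (w :: s).
  apply: (Hn _ (next c y) (prev c y)).
  - by apply: sub_walk (next_rel_keep _) _; rewrite /= E2 eqxx -E2 ps ls.
  - by case/andP: us.
  - move=> x xY; have := hopIter_c xY; rewrite -ms inE => /orP[/eqP xy|//].
    by rewrite -xy xY in yn.
  - exact: next_neq_prev.
  - exact: wX.
  - exact: pX.
  - exact: hopX_Y.
  - exact: hopX_Y.
  - by apply: contra v0c => h; rewrite -ms inE h orbT.
case=> c' [uc' cc' pc'].
have szc' : size c' = size c by rewrite (perm_size pc') -ss.
have lc' : longest f v c'.
  split=> //; last by rewrite szc'.
  rewrite (perm_mem pc') inE; apply/orP; right.
  by move: vc; rewrite -ms inE eq_sym (negbTE yv).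
have yc' : y \notin c'.
  rewrite (perm_mem pc') inE negb_or; case/andP: us => -> _; rewrite andbT.
  by apply: contraNneq v0c => <-.
have rc' : r \notin c'.
  rewrite (perm_mem pc') inE negb_or rv0 /=.
  by apply: contra rc => h; rewrite -ms inE h orbT.
by have := out lc' (eq_leq (esym szc')) yc' rc'; rewrite fyr.
Qed.

End Hop.

(* Everything is phrased through [adj] and membership, so that it is invariant
   under rotation and reversal of c. *)
Record hop_closed (T : finType) (f : rel T) (v v0 : T) (c : seq T) (X Y : {set T}) : Prop := HopClosed {
  hc_long : longest f v c;
  hc_v0 : v0 \notin c;
  hc_Xc : forall x, x \in X -> x \in c;
  hc_Xv : v \notin X;
  hc_Yc : forall y, y \in Y -> y \in c;
  hc_Yv : v \notin Y;
  hc_adj : forall y x, y \in Y -> adj c y x -> x \in X;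
  hc_max : forall y, y \in c -> y != v -> (forall x, adj c y x -> x \in X) -> y \in Y;
  hc_nbr : forall y x, y \in v0 |: Y -> f y x -> x \in X;
  hc_sep : forall x y, adj c x y -> x \in X -> y \notin X;
  hc_hop : forall D a b, walk (keep f c Y) a D b -> uniq D -> {subset Y <= D} -> a != b ->
    a \in X -> b \in X -> v0 \notin D -> v \in D -> size D < size c
}.

Lemma hop_exists (T : finType) (f : rel T) (v v0 : T) (c : seq T) :
  symmetric f -> irreflexive f -> longest f v c -> 2 < size c -> v0 \notin c ->
  (forall c' x y, longest f v c' -> size c <= size c' -> x \notin c' -> y \notin c' -> ~~ f x y) ->
  (forall y, f v y -> adj c v y) ->
  exists X Y, hop_closed f v v0 c X Y.
Proof.
move=> fs fi lc sc v0c out adjv; pose Y := hopIter f v v0 c #|T|; exists (hopX f v0 Y), Y.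
have [_ _ vc _] := lc.
have [P H] := spread_hops fs fi lc v0c #|T|.
have Yc y : y \in Y -> y \in c by apply: hopIter_c.
have nX y x : y \in v0 |: Y -> f y x -> x \in hopX f v0 Y.
  by move=> yY fyx; rewrite inE; apply/exists_inP; exists y.
split=> //.
- move=> x; rewrite inE => /exists_inP[y]; rewrite in_setU1 => yY; apply: contraTT => xc.
  case/orP: yY => [/eqP->|yY]; first exact: (out c).
  exact: (exchange fs fi lc sc v0c out adjv yY).
- exact: v_hopX.
- by rewrite /Y -hopY_fix in_set eqxx andbF.
- by move=> y x yY; apply: hopIterP; rewrite /hopIter iterS -/(hopIter _ _ _ _ _) hopY_fix.
- move=> y yc yv h; rewrite /Y -hopY_fix in_set yc yv /=.
  by apply/forallP => x; apply/implyP; apply: h.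
- move=> D a b pD uD YD ab aX bX vD.
  apply: (closable_long lc); apply: (H D a b pD uD YD ab aX bX _ _ vD).
    by apply: hopX_Y aX.
  by apply: hopX_Y bX.
Qed.

Lemma cycle_cat (T : eqType) (r : rel T) x A y B : cycle r ((x :: A) ++ y :: B) ->
  [/\ walk r x (x :: A) (last x A), r (last x A) y, walk r y (y :: B) (last y B) & r (last y B) x].
Proof.
rewrite /= rcons_path cat_path /= last_cat /= => /andP[/and3P[-> -> ->] ->].
by rewrite !eqxx.
Qed.

Lemma adj_eq (T : finType) (c c' : seq T) : next_rel c =2 next_rel c' -> adj c =2 adj c'.
Proof. by move=> h x y; rewrite /adj !h. Qed.

Lemma adj_rot (T : finType) (c : seq T) i : uniq c -> adj (rot i c) =2 adj c.
Proof. by move=> uc; apply: adj_eq; apply: next_rel_rot. Qed.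

Lemma adj_rev (T : finType) (c : seq T) : uniq c -> adj (rev c) =2 adj c.
Proof. by move=> uc x y; rewrite /adj !next_rel_rev // orbC. Qed.

Lemma hop_change (T : finType) (f : rel T) v v0 c c' X Y :
  hop_closed f v v0 c X Y -> longest f v c' -> perm_eq c c' -> adj c' =2 adj c ->
  hop_closed f v v0 c' X Y.
Proof.
case=> lc v0c Xc Xv Yc Yv aj mx nb sp hp lc' cc' ae.
have mE x : (x \in c') = (x \in c) by rewrite (perm_mem cc').
split=> //.
- by rewrite mE.
- by move=> x /Xc; rewrite mE.
- by move=> x /Yc; rewrite mE.
- by move=> y x; rewrite ae; apply: aj.
- move=> y; rewrite mE => yc yv h; apply: mx => // x; rewrite -ae; exact: h.
- by move=> x y; rewrite ae; apply: sp.
- move=> D a b pD; rewrite -(perm_size cc'); apply: hp.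
  by apply: sub_walk pD => x y; rewrite /keep ae.
Qed.

Lemma hop_rot (T : finType) (f : rel T) v v0 c X Y i :
  hop_closed f v v0 c X Y -> hop_closed f v v0 (rot i c) X Y.
Proof.
move=> hc; have lc := hc_long hc; apply: (hop_change hc).
- exact: longest_rot.
- by rewrite perm_sym perm_rot.
- by apply: adj_rot; case: lc.
Qed.

Lemma hop_rev (T : finType) (f : rel T) v v0 c X Y : symmetric f ->
  hop_closed f v v0 c X Y -> hop_closed f v v0 (rev c) X Y.
Proof.
move=> fs hc; have lc := hc_long hc; apply: (hop_change hc).
- exact: longest_rev.
- by rewrite perm_sym perm_rev.
- by apply: adj_rev; case: lc.
Qed.

(** * Independence and insertion properties of a hop-closed pair *)

Section Facts.
Variables (T : finType) (f : rel T) (v v0 : T) (X Y : {set T}).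
Hypotheses (fs : symmetric f) (fi : irreflexive f).

Section Fixed.
Variable c : seq T.
Hypothesis hc : hop_closed f v v0 c X Y.
Let uc : uniq c. Proof. by case: (hc_long hc). Qed.
Let cc : cycle f c. Proof. by case: (hc_long hc). Qed.
Let vc : v \in c. Proof. by case: (hc_long hc). Qed.

Lemma next_X a : a \in X -> next c a \notin X.
Proof. by move=> aX; apply: (hc_sep hc _ aX); apply: adj_next; apply: (hc_Xc hc). Qed.

Lemma prev_X a : a \in X -> prev c a \notin X.
Proof. by move=> aX; apply: (hc_sep hc _ aX); apply: (adj_prev (hc_long hc)); apply: (hc_Xc hc). Qed.

Lemma Y_notX y : y \in Y -> y \notin X.
Proof.
move=> yY; have yc := hc_Yc hc yY.
have nX := hc_adj hc yY (adj_next yc).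
by apply: (hc_sep hc _ nX); rewrite adj_sym adj_next.
Qed.

Lemma Y_nbr y x : y \in Y -> f y x -> x \in X.
Proof. by move=> yY; apply: (hc_nbr hc); rewrite in_setU1 yY orbT. Qed.

(** Otherwise reversing the arc from the successor of [a] to [a'] gives a path on all of [c] with
    both ends in X, against [hc_hop]. *)
Lemma succ_indep a a' : a \in X -> a' \in X -> ~~ f (next c a) (next c a').
Proof.
move=> aX aX'; case: (eqVneq a a') => [->|aa]; first by rewrite fi.
apply/negP => fp.
have ac := hc_Xc hc aX; have ac' := hc_Xc hc aX'.
have pY : next c a \notin Y.
  by apply: contra (next_X aX') => pY; apply: Y_nbr pY fp.
have pY' : next c a' \notin Y.
  by apply: contra (next_X aX) => pY'; apply: Y_nbr pY' _; rewrite fs.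
have [i [A [B [E h1 h2]]]] := split_two uc ac ac' aa.
have := hc_hop hc (D := rev A ++ B) (a := a') (b := a).
have pD : perm_eq (rev A ++ B) c.
  by rewrite (perm_trans (y := A ++ B)) //; [perm_tac | rewrite -E perm_rot perm_rot].
rewrite (perm_uniq pD) !(perm_mem pD) (perm_size pD) ltnn (hc_v0 hc) vc uc.
move=> H; suff : false by []. apply: H => //; last by rewrite eq_sym.
  have kh a0 s b0 : walk (next_rel c) a0 s b0 -> walk (keep f c Y) a0 s b0.
    by apply: sub_walk; apply: (next_rel_keep (hc_long hc)).
  apply: (walk_cat (walk_rev (keep_sym c fs Y) (kh _ _ _ h1)) _ (kh _ _ _ h2)).
  exact: keep_new.
by move=> y /(hc_Yc hc); rewrite (perm_mem pD).
Qed.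

(** The path of [succ_indep] with [r] in place of the edge has |c| + 1 vertices, again against
    [hc_hop]. *)
Lemma succ_common r a a' : r \notin c -> a \in X -> a' \in X ->
  f r (next c a) -> f r (next c a') -> a = a'.
Proof.
move=> rc aX aX' rp rp'; apply/eqP; case: (eqVneq a a') => // aa; exfalso.
have ac := hc_Xc hc aX; have ac' := hc_Xc hc aX'.
have rX : r \notin X by apply: contra rc; apply: hc_Xc hc _.
have rY : r \notin Y by apply: contra rc; apply: hc_Yc hc _.
have pY : next c a \notin Y by apply: contra rX => pY; apply: Y_nbr pY _; rewrite fs.
have pY' : next c a' \notin Y by apply: contra rX => pY'; apply: Y_nbr pY' _; rewrite fs.
have rv0 : r != v0.
  apply: contraNneq (next_X aX) => rv; rewrite rv in rp.
  by apply: (hc_nbr hc) rp; rewrite setU11.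
have [i [A [B [E h1 h2]]]] := split_two uc ac ac' aa.
have pD : perm_eq (rev A ++ [:: r] ++ B) (r :: c).
  rewrite (perm_trans (y := r :: A ++ B)) //; first by perm_tac.
  by rewrite perm_cons -E perm_rot perm_rot.
have kh a0 s b0 : walk (next_rel c) a0 s b0 -> walk (keep f c Y) a0 s b0.
  by apply: sub_walk; apply: (next_rel_keep (hc_long hc)).
have p'r : f (next c a) r by rewrite fs.
have walkD : walk (keep f c Y) a' (rev A ++ [:: r] ++ B) a.
  apply: (walk_cat (walk_rev (keep_sym c fs Y) (kh _ _ _ h1)) (keep_new c pY rY p'r)).
  by apply: (walk_cat (walk1 _ r) _ (kh _ _ _ h2)); exact: keep_new.
have := hc_hop hc walkD; rewrite (perm_uniq pD) !(perm_mem pD) (perm_size pD) /= rc uc ltnNge leqnSn.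
rewrite !inE negb_or [v0 == r]eq_sym rv0 (hc_v0 hc) vc orbT eq_sym aa.
move=> H; suff : false by []. apply: H => // y /(hc_Yc hc) yc.
by rewrite (perm_mem pD) inE yc orbT.
Qed.
End Fixed.

Lemma pred_indep c a a' : hop_closed f v v0 c X Y -> a \in X -> a' \in X -> ~~ f (prev c a) (prev c a').
Proof.
move=> hc aX aX'; have [uc _ _ _] := hc_long hc.
by rewrite -!(next_rev uc); apply: succ_indep; first exact: hop_rev.
Qed.

Lemma pred_common c r a a' : hop_closed f v v0 c X Y -> r \notin c -> a \in X -> a' \in X ->
  f r (prev c a) -> f r (prev c a') -> a = a'.
Proof.
move=> hc rc aX aX'; have [uc _ _ _] := hc_long hc.
by rewrite -!(next_rev uc); apply: succ_common; rewrite ?mem_rev //; exact: hop_rev.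
Qed.

(** The segment [A] is spliced, in either direction, between [w] and its successor. The new edges
    avoid Y, and the resulting path on all of [c] from [b] to [a] contradicts [hc_hop]. *)
Lemma insertion c i A B a b p q w : hop_closed f v v0 c X Y ->
  rot i c = A ++ B -> walk (next_rel c) p A q -> walk (next_rel c) b B a ->
  a \in X -> b \in X -> a != b -> (forall y, y \in A -> y \notin Y) ->
  w \in B -> w != a -> w \notin Y -> next c w \notin Y ->
  ~~ (f p w && f q (next c w)) /\ ~~ (f q w && f p (next c w)).
Proof.
move=> hc E hA hB aX bX ab AY wB wa wY wY'.
have [uc cc vc _] := hc_long hc.
have kh a0 s b0 : walk (next_rel c) a0 s b0 -> walk (keep f c Y) a0 s b0.
    by apply: sub_walk; apply: (next_rel_keep (hc_long hc)).
have ks := keep_sym c fs Y.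
have [s1 [s2 EB]] : exists s1 s2, B = rcons s1 w ++ next c w :: s2.
  case/splitPr: wB hB => s1 [|x s2].
    by move=> /walk_last [s Es]; move: Es wa; rewrite cats1 => /rcons_inj[_ ->]; rewrite eqxx.
  rewrite -cat_rcons => /walk_cat_inv[_ /andP[_ /eqP<-] _].
  by exists s1, s2.
have : walk (keep f c Y) b B a by apply: kh.
rewrite {1}EB => /walk_cat_inv[h1 _ h2].
have [pA qA] := walk_mem hA.
have concl D : perm_eq D (A ++ B) -> walk (keep f c Y) b D a -> False.
  move=> pD walk; have pD' : perm_eq D c by rewrite (perm_trans pD) // -E perm_rot.
  have := hc_hop hc walk; rewrite (perm_uniq pD') !(perm_mem pD') (perm_size pD') ltnn (hc_v0 hc) vc uc eq_sym ab.
  move=> H; suff : false by []. apply: H => //.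
  by move=> y /(hc_Yc hc); rewrite (perm_mem pD').
split; apply/negP => /andP[H1 H2].
  apply: (concl (rcons s1 w ++ A ++ next c w :: s2)); first by rewrite EB; perm_tac.
  apply: (walk_cat h1 _ (walk_cat (kh _ _ _ hA) _ h2)); apply: keep_new => //; try exact: AY.
  by rewrite fs.
apply: (concl (rcons s1 w ++ rev A ++ next c w :: s2)); first by rewrite EB; perm_tac.
apply: (walk_cat h1 _ (walk_cat (walk_rev ks (kh _ _ _ hA)) _ h2)); apply: keep_new => //; try exact: AY.
by rewrite fs.
Qed.
End Facts.

(** * Pieces of a duplicate-free concatenation *)

Section Flat.
Variables (S T : eqType) (g : S -> seq T).

Lemma flat_inj bs b1 b2 w : uniq (flatten [seq g b | b <- bs]) ->
  b1 \in bs -> b2 \in bs -> w \in g b1 -> w \in g b2 -> b1 = b2.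
Proof.
have mem bs' b : b \in bs' -> w \in g b -> w \in flatten [seq g b' | b' <- bs'].
  by move=> bbs wb; apply/flatten_mapP; exists b.
elim: bs => //= b bs IH; rewrite cat_uniq => /and3P[_ /hasPn h /IH{}IH].
rewrite !inE => /orP[/eqP->|b1s] /orP[/eqP->|b2s] // w1 w2.
- by have := h _ (mem _ _ b2s w2); rewrite w1.
- by have := h _ (mem _ _ b1s w1); rewrite w2.
- exact: IH.
Qed.

Lemma flat_uniq bs : uniq (flatten [seq g b | b <- bs]) -> (forall b, g b != [::]) -> uniq bs.
Proof.
move=> + gn; elim: bs => //= b bs IH; rewrite cat_uniq => /and3P[_ /hasPn h /IH->].
rewrite andbT; apply/negP => bbs; have := gn b; case E : (g b) => [|w s] // _.
have wb : w \in g b by rewrite E mem_head.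
by have /h : w \in flatten [seq g b | b <- bs] by [apply/flatten_mapP; exists b]; rewrite wb.
Qed.

Lemma flat_subseq (h : S -> seq T) (P : pred S) bs :
  (forall b, b \in bs -> P b -> subseq (h b) (g b)) ->
  subseq (flatten [seq h b | b <- bs & P b]) (flatten [seq g b | b <- bs]).
Proof.
elim: bs => //= b bs IH H.
have {}IH := IH (fun b' bb' => H b' (mem_behead (s := b :: bs) bb')).
case: ifP => Pb /=; first by apply: cat_subseq IH; apply: H; rewrite ?mem_head.
by apply: subseq_trans IH _; apply: suffix_subseq.
Qed.
End Flat.

(** * Segments of the cycle between consecutive vertices of X *)

(** In use, [b.1] is a vertex of X and [b.2] the segment that follows it on the cycle. *)
Definition block (T : Type) (b : T * seq T) := b.1 :: b.2.

Lemma blocks_exist (T : eqType) (P : pred T) s : exists t bs,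
  [/\ s = t ++ flatten [seq block b | b <- bs], ~~ has P t &
      all (fun b : T * seq T => P b.1 && ~~ has P b.2) bs].
Proof.
elim: s => [|x s [t [bs [-> ht hb]]]]; first by exists [::], [::].
case Px : (P x); first by exists [::], ((x, t) :: bs); rewrite /= Px ht hb.
by exists (x :: t), bs; rewrite /= Px.
Qed.

(** Consecutive terms are paired off; in odd length one term stays alone and is bounded only by
    zero. *)
Lemma pair_sum (T : Type) (F : T -> nat) g s :
  (forall s1 x y s2, s = s1 ++ x :: y :: s2 -> g.*2 <= F x + F y) ->
  g * size s <= \sum_(w <- s) F w + g * odd (size s).
Proof.
have [n] := ubnP (size s); elim: n s => // n IH [|x [|y s]] sn H.
- by rewrite big_nil muln0.
- by rewrite big_seq1 /= muln1 leq_addl.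
have := IH s (ltnW sn).
have := H [::] x y s erefl; rewrite !big_cons /= negbK => h1 h2.
have : g * size s <= \sum_(w <- s) F w + g * odd (size s).
  by apply: h2 => s1 p q s2 E; apply: (H (x :: y :: s1)); rewrite E.
by move: h1; clear; nia.
Qed.

(** In odd length the first term is the one left alone, and its own bound removes the parity
    loss. *)
Lemma pair_sum_head (T : Type) (F : T -> nat) g x s :
  (forall s1 x' y s2, x :: s = s1 ++ x' :: y :: s2 -> g.*2 <= F x' + F y) ->
  g <= F x -> g * (size s).+1 <= \sum_(w <- x :: s) F w.
Proof.
move=> H Fx; case o : (odd (size s)).
  by have := pair_sum H; rewrite /= o muln0 addn0.
rewrite big_cons mulnS leq_add //.
have := pair_sum (F := F) (g := g) (s := s); rewrite o muln0 addn0; apply.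
by move=> s1 p q s2 E; apply: (H (x :: s1)); rewrite E.
Qed.

Lemma sum_count (T : Type) (P : pred T) s : \sum_(x <- s) P x = count P s.
Proof. by elim: s => [|x s IH]; rewrite ?big_nil ?big_cons //= IH. Qed.

Lemma sum_le1 (T : eqType) (P : pred T) s : uniq s ->
  (forall x y, x \in s -> y \in s -> P x -> P y -> x = y) -> \sum_(x <- s) P x <= 1.
Proof.
move=> us H; rewrite sum_count -size_filter.
case E : (filter P s) => [|x t] //.
have xin : x \in filter P s by rewrite E mem_head.
rewrite -E -[1]/(size [:: x]); apply: uniq_leq_size; first exact: filter_uniq.
move=> y; move: xin; rewrite !mem_filter inE => /andP[Px xs] /andP[Py ys].
by rewrite (H y x).
Qed.

Section Blocks.
Variables (T : finType) (f : rel T) (v v0 : T) (X Y : {set T}) (c : seq T) (bs : seq (T * seq T)).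
Hypotheses (fs : symmetric f) (fi : irreflexive f) (hc : hop_closed f v v0 c X Y)
  (cE : c = flatten [seq block b | b <- bs])
  (bsX : forall b, b \in bs -> b.1 \in X) (bsN : forall b w, b \in bs -> w \in b.2 -> w \notin X)
  (bs2 : 1 < size bs).

(** Segments are nonempty by [block_ne], so the default [v] is never reached. *)
Definition block_head (b : T * seq T) := head v b.2.
Definition block_last (b : T * seq T) := last v b.2.
Definition is_long (b : T * seq T) := (1 < size b.2) && (v \notin b.2).

Let uc : uniq c. Proof. by case: (hc_long hc). Qed.
Let cc : cycle f c. Proof. by case: (hc_long hc). Qed.
Let vc : v \in c. Proof. by case: (hc_long hc). Qed.

(** The cycle is rotated so that the segment comes first. The rest then runs from the next vertex
    [b'] of X to [b.1], and these differ because there are at least two blocks. *)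
Lemma block_view b : b \in bs -> exists i B b',
  [/\ rot i c = b.2 ++ B, walk (next_rel c) (block_head b) b.2 (block_last b), walk (next_rel c) b' B b.1 &
      [/\ b' \in X, b' != b.1, next c (block_last b) = b' & next c b.1 = block_head b]].
Proof.
move=> bbs; have [s1 [s2 E]] : exists s1 s2, bs = s1 ++ b :: s2.
  by case/splitPr: bbs => s1 s2; exists s1, s2.
pose t1 := flatten [seq block b | b <- s1]; pose t2 := flatten [seq block b | b <- s2].
have cE' : c = rcons t1 b.1 ++ (b.2 ++ t2).
  by rewrite cE E map_cat flatten_cat /= cat_rcons.
have rE : rot (size (rcons t1 b.1)) c = b.2 ++ rcons (t2 ++ t1) b.1.
  by rewrite cE' rot_size_cat -!cats1 !catA.
have [b' [B' [tE b's]]] : exists b' B', t2 ++ t1 = b' :: B' /\ b' \in X.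
  rewrite /t1 /t2 -flatten_cat -map_cat.
  have : forall d, d \in s2 ++ s1 -> d \in bs.
    by move=> d; rewrite E !mem_cat inE => /orP[]->; rewrite ?orbT.
  have : 0 < size (s2 ++ s1) by move: bs2; rewrite E !size_cat /=; lia.
  case: (s2 ++ s1) => //= d s _ H; exists d.1, (d.2 ++ flatten [seq block b | b <- s]).
  by split=> //; apply/bsX/H/mem_head.
rewrite tE rcons_cons in rE.
have ur : uniq (b.2 ++ b' :: rcons B' b.1) by rewrite -rE rot_uniq.
have cr : cycle (next_rel c) (b.2 ++ b' :: rcons B' b.1).
  by rewrite -rE -(eq_cycle (next_rel_rot (size (rcons t1 b.1)) uc)) next_rel_cycle // rot_uniq.
have b'b : b' != b.1.
  move: ur; rewrite cat_uniq => /and3P[_ _ /= /andP[+ _]].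
  by apply: contraNneq => ->; rewrite mem_rcons mem_head.
have b1c : b.1 \in c by apply: (hc_Xc hc); apply: bsX.
(* An empty segment would make two vertices of X consecutive. *)
case E2 : b.2 rE ur cr => [|x S] rE ur cr.
  exfalso; move: cr; rewrite /= rcons_path last_rcons => /andP[_ /andP[_ /eqP b'E]].
  have := next_X hc (bsX bbs); rewrite -b'E b's //.
have [h1 l1 h2 l2] := cycle_cat cr; rewrite last_rcons in h2 l2.
exists (size (rcons t1 b.1)), (b' :: rcons B' b.1), b'; rewrite /block_head /block_last E2 /=; split=> //.
by case/andP: l1 => _ /eqP<-; case/andP: l2 => _ /eqP<-.
Qed.

Lemma block_ne b : b \in bs -> b.2 != [::].
Proof. by move=> /block_view[i [B [b' [_ h _ _]]]]; case: (b.2) h. Qed.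

Lemma block_head_mem b : b \in bs -> block_head b \in b.2.
Proof. by move=> /block_view[i [B [b' [_ h _ _]]]]; case: (walk_mem h). Qed.

Lemma block_last_mem b : b \in bs -> block_last b \in b.2.
Proof. by move=> /block_view[i [B [b' [_ h _ _]]]]; case: (walk_mem h). Qed.

Lemma block_headE b : b \in bs -> block_head b = next c b.1.
Proof. by move=> /block_view[i [B [b' [_ _ _ [_ _ _ ->]]]]]. Qed.

Lemma block_lastE b : b \in bs -> exists2 b', b' \in X & block_last b = prev c b'.
Proof.
move=> /block_view[i [B [b' [_ _ _ [b'X _ E _]]]]]; exists b' => //.
by rewrite -E prev_next.
Qed.

Lemma block_mem b w : b \in bs -> w \in b.2 -> w \in c.
Proof.
by move=> bbs wb; rewrite cE; apply/flatten_mapP; exists b; rewrite // inE wb orbT.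
Qed.

Lemma block_inj b1 b2 w : b1 \in bs -> b2 \in bs -> w \in b1.2 -> w \in b2.2 -> b1 = b2.
Proof.
move=> h1 h2 w1 w2; have uc' := uc; rewrite cE in uc'.
by apply: (flat_inj (w := w) uc' h1 h2); rewrite /block inE ?w1 ?w2 orbT.
Qed.

Lemma bs_uniq : uniq bs.
Proof. by have uc' := uc; rewrite cE in uc'; apply: (flat_uniq uc'). Qed.

Lemma block_step b s1 x y s2 : b \in bs -> b.2 = s1 ++ x :: y :: s2 -> y = next c x.
Proof.
move=> /block_view[i [B [b' [_ h _ _]]]] E; move: h; rewrite E -cat_rcons.
by case/walk_cat_inv => _ /andP[_ /eqP].
Qed.

Lemma block_exists w : w \in c -> w \notin X -> exists2 b, b \in bs & w \in b.2.
Proof.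
rewrite {1}cE => /flatten_mapP[b bbs]; rewrite inE => /orP[/eqP->|]; last by exists b.
by rewrite bsX.
Qed.

(** Both cycle neighbours of a vertex of Y lie in X, but in a segment of at least two vertices each
    has a neighbour inside the segment. *)
Lemma block_Y b w : b \in bs -> w \in b.2 -> 1 < size b.2 -> w \notin Y.
Proof.
move=> bbs wb sb; apply/negP => wY.
have wc := block_mem bbs wb.
have [s1 [s2 E]] : exists s1 s2, b.2 = s1 ++ w :: s2.
  by case/splitPr: wb => s1 s2; exists s1, s2.
case: s2 E => [|y s2] E.
  case/lastP: s1 E => [|s1 x] E; first by rewrite E in sb.
  rewrite cat_rcons in E; have wE := block_step bbs E.
  have xb : x \in b.2 by rewrite E mem_cat mem_head orbT.
  have := bsN bbs xb; rewrite (hc_adj hc wY) // adj_sym wE.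
  by apply: adj_next; apply: block_mem xb.
have yE := block_step bbs E.
have yb : y \in b.2 by rewrite E mem_cat !inE eqxx !orbT.
by have := bsN bbs yb; rewrite (hc_adj hc wY) // yE; apply: adj_next.
Qed.

Lemma block_single b w : b \in bs -> w \in b.2 -> size b.2 = 1 -> w != v -> w \in Y.
Proof.
move=> bbs wb sb wv; have wc := block_mem bbs wb.
have [i [B [b' [_ _ _ [b'X _ E1 E2]]]]] := block_view bbs.
have : b.2 = [:: w].
  by case: (b.2) wb sb => [|x [|? ?]] //; rewrite inE => /eqP->.
move=> E; rewrite /block_last /block_head E /= in E1 E2.
apply: (hc_max hc wc wv) => x /orP[] /andP[xc /eqP]; first by rewrite E1 => ->.
by rewrite -E2 => /(can_inj (prev_next uc)) <-; apply: bsX.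
Qed.

Lemma block_insertion b w : b \in bs -> is_long b -> w \in c -> w \notin X -> next c w \notin X ->
  w \notin b.2 -> w \notin Y -> next c w \notin Y ->
  ~~ (f (block_head b) w && f (block_last b) (next c w)) /\ ~~ (f (block_last b) w && f (block_head b) (next c w)).
Proof.
move=> bbs /andP[sb vb] wc wX nX wb wY nY.
have [i [B [b' [E h1 h2 [b'X b'b _ _]]]]] := block_view bbs.
apply: (insertion fs hc E h1 h2) => //.
- exact: bsX.
- by rewrite eq_sym.
- by move=> y yb; apply: block_Y yb sb.
- by move: wc; rewrite -(mem_rot i) E mem_cat (negbTE wb).
- by apply: contraNneq wX => ->; apply: bsX.
Qed.

Lemma card_X : #|X| = size bs.
Proof.
have -> : #|X| = count (mem X) c.
  rewrite -size_filter -(card_uniqP (filter_uniq _ uc)); apply: eq_card => x.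
  rewrite mem_filter /=; case: (boolP (x \in X)) => // /(hc_Xc hc)->//.
rewrite cE count_flatten -map_comp sumnE big_map -(sum1_size bs) big_seq [RHS]big_seq.
apply: eq_bigr => b bbs; rewrite /= bsX //.
suff /eqP -> : count (mem X) b.2 == 0 by [].
by rewrite -leqn0 leqNgt -has_count; apply/hasPn => w; apply: bsN.
Qed.

Lemma sum_blocks (F : T -> nat) :
  \sum_(w <- c) F w = \sum_(b <- bs) (F b.1 + \sum_(w <- b.2) F w).
Proof.
rewrite {1}cE big_flatten big_map; apply: eq_bigr => b _; by rewrite big_cons.
Qed.

Lemma card_Y : #|Y| = count (fun b => (size b.2 == 1) && (v \notin b.2)) bs.
Proof.
have -> : #|Y| = count (mem Y) c.
  rewrite -size_filter -(card_uniqP (filter_uniq _ uc)); apply: eq_card => x.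
  rewrite mem_filter /=; case: (boolP (x \in Y)) => // /(hc_Yc hc)->//.
rewrite -!sum_count sum_blocks big_seq [RHS]big_seq; apply: eq_bigr => b bbs.
have -> : mem Y b.1 = false by apply: contraTF (bsX bbs); apply: (Y_notX hc).
case: (ltngtP (size b.2) 1) => sb /=.
- by have := block_ne bbs; case: (b.2) sb.
- by rewrite big_seq big1 // => w wb; rewrite /= (negbTE (block_Y bbs wb sb)).
case E : b.2 sb => [|w [|? ?]] // _.
have wb : w \in b.2 by rewrite E mem_head.
rewrite big_seq1 inE add0n /=; congr nat_of_bool.
case: (eqVneq v w) => [<-|vw]; first exact: negbTE (hc_Yv hc).
by apply: (block_single bbs wb); rewrite ?E // eq_sym.
Qed.

Lemma count_v : count (fun b : T * seq T => v \in b.2) bs = 1.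
Proof.
have : count_mem v c = 1 by rewrite count_uniq_mem // vc.
rewrite -!sum_count sum_blocks => <-; rewrite big_seq [RHS]big_seq; apply: eq_bigr => b bbs.
have -> : pred1 v b.1 = false by apply: contraNF (hc_Xv hc) => /eqP<-; apply: bsX.
rewrite sum_count count_uniq_mem //.
have [i [B [b' [E _ _ _]]]] := block_view bbs.
by have := rot_uniq i c; rewrite uc E cat_uniq => /andP[].
Qed.

(** Each block has one vertex of X, and its segment is a single vertex of Y, or long, or the one
    containing [v]. *)
Lemma count_blocks : #|X| = #|Y| + count is_long bs + 1.
Proof.
transitivity (#|Y| + count is_long bs + count (fun b : T * seq T => v \in b.2) bs); last by rewrite count_v.
rewrite card_X card_Y -!sum_count -!big_split -sum1_size /=.
rewrite big_seq [RHS]big_seq; apply: eq_bigr => b bbs; rewrite /is_long.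
by have := block_ne bbs; rewrite -size_eq0; case: (size b.2) => [|[|n]] //= _; case: (v \in b.2).
Qed.

End Blocks.

(* s segments have at least two vertices and avoid v; N and M count the vertices
   of the rest, respectively of these segments, that are not first or last in
   such a segment; h those of the segment of v, r those off the cycle; o is the
   number of these segments of odd size; g = k - s - N.  The bounds add up to
   g (s + N + 1 - o) + 4 + 2 r (s - 1) <= 2 k. *)
Lemma segment_counting k n x y s N M h r eps o C S F B RR rho EX g :
 k * x.+1 = EX + S + k * y.+1 -> 2*eps <= EX -> x = y+s+1 -> n = C.+1+r ->
 n = x.+1+y.+1+(2*s+N) -> N = M+h+r -> S = F+B+RR ->
 2*k*s + g*M + 2*x*s <= F + C*s + (M+s) + rho + g*o ->
 g.+1*h <= B -> k.+1*r <= RR+rho+r*N -> rho <= 2*r -> o <= s -> o <= M -> 2 <= h+eps ->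
 k.+1*(2*s+N) <= S + (2*s+N)*(2*s+N) ->
 n <= 3*k-6 -> k <= x.+1 -> 3 < k -> g + s + N = k ->
 s = 0 /\ N = 0.
Proof.
move=> e1 e2 e3 e4 e5 e6 e7 e8 e9 e10 e11 e12 e13 e14 e15 e16 e17 e18 e19.
(* Here n = 2 x + 1 + s + N and x + 1 >= k, so n <= 3 k - 6 leaves s + N <= k - 5. *)
have g5 : 5 <= g by clear - e3 e4 e5 e16 e17 e18 e19; lia.
have Cs : C*s + r*s = 2*x*s + s*s + N*s.
  have Cx : C + r = 2*x + s + N by clear - e3 e4 e5; lia.
  by rewrite -mulnDl Cx !mulnDl.
have kS : k * s.+1 = EX + S.
  by move: e1; rewrite e3 -!addnS; clear; lia.
clear e1 e4 e5 e16 e17 e18 e3.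
(* For s <= 1 the trivial bound [e15] on S suffices; the finer bounds enter for s >= 2. *)
have [s0|[s1|s2]] : s = 0 \/ s = 1 \/ 2 <= s by clear; lia.
- split=> //. case: N => [//|N] in e6 e10 e15 e19 Cs *. exfalso.
  subst k s. clear - e2 e14 e15 kS g5 e6.
  nia.
- exfalso.
  subst k s. clear - e2 e14 e15 kS g5 e6. nia.
exfalso.
have main : g * (s + N) + 4 + 2 * (r * s) <= g * o + g + 2 * (s + N) + 2 * r.
  subst k S N. clear - e2 e14 kS e8 e9 e10 e11 e13 Cs. 
  lia.
(* With g >= 5 and s >= 1, [main] becomes 3 p + 2 <= 2 o, the negation of the second conjunct. *)
have [p [Ep op]] : exists p, s + N = o + 1 + p /\ 2 * o < 3 * p + 2.
  exists (s + N - o - 1); clear - e6 e12 e13 s2; lia.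
rewrite Ep in main.
have : g * p + 4 + 2 * (r * s) <= 2 * (o + 1 + p) + 2 * r by clear - main; lia.
have : 5 * p <= g * p by rewrite leq_mul2r g5 orbT.
have : 2 * r <= 2 * (r * s) by rewrite leq_mul2l leq_pmulr ?orbT //; apply: ltnW.
clear - op; lia.
Qed.

(** * Degrees into a vertex set *)

Section Degree.
Variables (T : finType) (e : rel T).
(** A sum of booleans, so that double counting becomes an exchange of sums. *)
Definition deg (A : {set T}) w : nat := \sum_(y in A) e w y.

Lemma deg_T w : deg setT w = #|nbhd e w|.
Proof. by rewrite /deg -sum1_card big_mkcond [RHS]big_mkcond; apply: eq_bigr => y _; rewrite !inE; case: (e w y). Qed.

Lemma deg_lt (A : {set T}) w : irreflexive e -> w \in A -> deg A w < #|A|.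
Proof.
move=> ei wA; rewrite /deg (bigD1 w) //= ei add0n (cardsD1 w) wA add1n ltnS.
rewrite -sum1_card big_mkcond [X in _ <= X]big_mkcond; apply: leq_sum => y _.
by rewrite !inE; case: (y == w); case: (y \in A); case: (e w y).
Qed.

Lemma sum_deg (A B : {set T}) : symmetric e -> \sum_(x in A) deg B x = \sum_(y in B) deg A y.
Proof. by move=> es; rewrite /deg exchange_big; do 2!apply: eq_bigr => ? _; rewrite es. Qed.

Lemma sum_eq_mem (A : {set T}) a : \sum_(y in A) (y == a) = (a \in A).
Proof.
case: (boolP (a \in A)) => aA; last by rewrite big1 // => y yA; case: eqVneq aA => // <-; rewrite yA.
by rewrite (bigD1 a) //= eqxx big1 // => y /andP[_ /negbTE->].
Qed.
End Degree.

(** * Counting edges between X + v and the rest *)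

Section Count.
Variables (T : finType) (e : rel T) (k : nat) (u v z v0 : T).
Hypotheses (es : symmetric e) (ei : irreflexive e) (ereg : regular e k)
  (uvz : uniq [:: u; v; z]) (euv : e u v) (evz : e v z).
Let f := thin e u v z.
Variables (X Y : {set T}) (c : seq T) (bs : seq (T * seq T)).
Hypotheses (hc : hop_closed f v v0 c X Y)
  (cE : c = flatten [seq block b | b <- bs])
  (bsX : forall b, b \in bs -> b.1 \in X) (bsN : forall b w, b \in bs -> w \in b.2 -> w \notin X)
  (bs2 : 1 < size bs) (sc : 2 < size c).

Let fs : symmetric f. Proof. exact: thin_sym. Qed.
Let fi : irreflexive f. Proof. exact: thin_irr. Qed.
Let uc : uniq c. Proof. by case: (hc_long hc). Qed.
Let cc : cycle f c. Proof. by case: (hc_long hc). Qed.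
Let vc : v \in c. Proof. by case: (hc_long hc). Qed.

Definition Xhub := v |: X.
Definition Yfull := v0 |: Y.
Definition Rest := ~: (Xhub :|: Yfull).
Definition Outer := [set r | (r \notin c) && (r != v0)].

Notation deg := (deg e).
Notation hd := (block_head v).
Notation lst := (block_last v).
Notation long := (is_long v).

Lemma in_Rest w : (w \in Rest) = [&& w != v, w \notin X, w != v0 & w \notin Y].
Proof. by rewrite !inE !negb_or -andbA. Qed.

Lemma v0v : v0 != v. Proof. by apply: contraNneq (hc_v0 hc) => ->. Qed.

Lemma Outer_Rest r : r \in Outer -> r \in Rest.
Proof.
rewrite in_Rest inE => /andP[rc ->]; rewrite /=; apply/and3P; split.
- by apply: contraNneq rc => ->.
- by apply: contra rc; apply: hc_Xc hc _.
- by apply: contra rc; apply: hc_Yc hc _.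
Qed.

Lemma Rest_split w : w \in Rest -> (w \in c) (+) (w \in Outer).
Proof. by rewrite in_Rest inE => /and4P[_ _ -> _]; rewrite andbT addbN addbb. Qed.

(** For a vertex other than [v], passing from [f] back to [e] adds at most the neighbour [v]. *)
Lemma Yfull_nbr y x : y \in Yfull -> e y x -> x \in Xhub.
Proof.
move=> yY eyx; rewrite in_setU1; case: eqVneq => //= xv.
apply: (hc_nbr hc yY); rewrite /f thin_off //.
move: yY; rewrite in_setU1 => /orP[/eqP->|yY]; first exact: v0v.
by apply: contraTneq yY => ->; apply: hc_Yv hc.
Qed.

Lemma hub_disj w : w \in Xhub -> w \notin Yfull.
Proof.
rewrite !in_setU1 negb_or => /orP[/eqP->|wX]; first by rewrite eq_sym v0v (hc_Yv hc).
apply/andP; split; last by apply: contraTN wX; apply: (Y_notX hc).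
by apply: contraTneq wX => ->; apply: contra (hc_v0 hc); apply: hc_Xc hc _.
Qed.

Lemma deg3 w : deg Xhub w + deg Yfull w + deg Rest w = k.
Proof.
rewrite -(ereg w) -deg_T /deg ![\sum_(y in _) _]big_mkcond -!big_split /=.
apply: eq_bigr => y _; rewrite in_setT in_setC in_setU; have := @hub_disj y.
by case: (y \in Xhub); case: (y \in Yfull) => //= h; rewrite ?addn0 //; have := h isT.
Qed.

Lemma deg_Rest w : w \in Rest -> deg Xhub w + deg Rest w = k.
Proof.
move=> wL; rewrite -(deg3 w) [deg Yfull w]big1 ?addn0 // => y yY.
case ewy : (e w y) => //; rewrite es in ewy.
by move: wL; rewrite in_setC in_setU (Yfull_nbr yY ewy).
Qed.

(** The degrees over X + v are summed. All k edges at a vertex of Y + v0 end in X + v, and edges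
    inside X + v are counted twice. *)
Lemma edge_count : k * #|X|.+1 = \sum_(x in Xhub) deg Xhub x + \sum_(w in Rest) deg Xhub w + k * #|Y|.+1.
Proof.
have -> : #|X|.+1 = #|Xhub| by rewrite cardsU1 (hc_Xv hc).
have -> : #|Y|.+1 = #|Yfull|.
  by rewrite cardsU1; have -> : v0 \notin Y by apply: contra (hc_v0 hc); apply: hc_Yc hc _.
have -> : k * #|Xhub| = \sum_(x in Xhub) (deg Xhub x + deg Yfull x + deg Rest x).
  by rewrite mulnC -sum_nat_const; apply: eq_bigr => x _; rewrite deg3.
rewrite !big_split /= [\sum_(x in Xhub) deg Rest x]sum_deg // addnAC; congr (_ + _).
rewrite sum_deg // mulnC -sum_nat_const; apply: eq_bigr => y yY.
rewrite -(ereg y) -deg_T /deg big_mkcond [RHS]big_mkcond /=; apply: eq_bigr => x _.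
rewrite in_setT; case: (boolP (x \in Xhub)) => // xX.
by case eyx : (e y x) => //; rewrite (Yfull_nbr yY eyx) in xX.
Qed.

Definition eps := (u \in X) + (z \in X).

Lemma deg_v_X : eps <= deg X v.
Proof.
have [uv zv uz] := uvz_neq uvz.
rewrite /eps -!sum_eq_mem -big_split /=; apply: leq_sum => y _.
case: (eqVneq y u) => [->|_]; first by rewrite es euv (negbTE uz).
by case: (eqVneq y z) => [->|]; rewrite ?evz.
Qed.

(** The edges from [v] to those of [u], [z] that lie in X are counted from both ends. *)
Lemma edges_in_X : 2 * eps <= \sum_(x in Xhub) deg Xhub x.
Proof.
rewrite (big_setD1 v) ?setU11 //= mul2n -addnn; have h := deg_v_X.
have XvD : Xhub :\ v = X by rewrite /Xhub setU1K // (hc_Xv hc).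
apply: leq_add.
  apply: leq_trans h _; rewrite /deg [X in _ <= X](big_setD1 v) ?setU11 //= XvD.
  exact: leq_addl.
rewrite XvD; apply: leq_trans h _; apply: leq_sum => x xX.
by rewrite /deg (big_setD1 v) ?setU11 //= es leq_addr.
Qed.

(** * Ends of the long segments and their neighbours *)

Definition ends := flatten [seq [:: hd b; lst b] | b <- bs & long b].
Definition Inner := Rest :\: [set w in ends].
Definition dends w := \sum_(b <- bs | long b) (e w (hd b) + e w (lst b)).
Definition nlong := count long bs.

Lemma block_Rest b w : b \in bs -> w \in b.2 -> 1 < size b.2 -> w != v -> w \in Rest.
Proof.
move=> bbs wb sb wv; rewrite in_Rest wv (bsN bbs wb) (block_Y hc cE bsX bsN bs2 bbs wb sb) andbT /=.
by apply: contraNneq (hc_v0 hc) => <-; apply: (block_mem cE bbs wb).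
Qed.

Lemma long_Rest b w : b \in bs -> long b -> w \in b.2 -> w \in Rest.
Proof.
move=> bbs /andP[sb vb] wb; apply: (block_Rest bbs wb sb).
by apply: contraNneq vb => <-.
Qed.

(** A long segment has at least two vertices, so its first and last are distinct and [ends] is a
    subsequence of the cycle. *)
Lemma ends_uniq : uniq ends.
Proof.
have := uc; rewrite cE; apply: subseq_uniq; apply: flat_subseq => b _ /andP[].
rewrite /block /block_head /block_last; case: (b.2) => [|x [|y s]] // _ _.
apply: subseq_trans (subseq_cons _ _).
by rewrite [head _ _]/= [last _ _]/= -cat1s -(cat1s x) cat_subseq // sub1seq mem_last.
Qed.

Lemma ends_sub w : w \in ends -> w \in Rest.
Proof.
move=> /flatten_mapP[b]; rewrite mem_filter => /andP[lb bbs] wE; rewrite !inE in wE.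
by case/pred2P: wE => ->; apply: (long_Rest bbs lb); [apply: (block_head_mem hc cE bsX bs2) | apply: (block_last_mem hc cE bsX bs2)].
Qed.

Lemma size_ends : size ends = 2 * nlong.
Proof. by rewrite /ends /nlong -size_filter; elim: (filter _ _) => //= b s ->; rewrite mulnS. Qed.

Lemma card_Rest : #|Rest| = 2 * nlong + #|Inner|.
Proof.
rewrite -size_ends -(card_uniqP ends_uniq) -(cardsID [set w in ends] Rest); congr (_ + _).
apply: eq_card => w; rewrite !inE; case: (boolP (w \in ends)) => [we|]; last by rewrite andbF.
by have := ends_sub we; rewrite !inE andbT => ->.
Qed.

Lemma deg_ends w : deg Rest w = dends w + deg Inner w.
Proof.
rewrite /deg (big_setID [set w in ends]) /=; congr (_ + _).
transitivity (\sum_(y <- ends) e w y).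
  rewrite big_uniq ?ends_uniq //=; apply: eq_bigl => y; rewrite inE inE andbC.
  by case: (boolP (y \in ends)) => // /ends_sub->.
rewrite /ends big_flatten big_map /dends big_filter.
by apply: eq_bigr => b _; rewrite big_cons big_seq1.
Qed.

Lemma Rest_neq_v w : w \in Rest -> w != v. Proof. by rewrite in_Rest => /and4P[]. Qed.

Lemma f_e x y : x != v -> y != v -> f x y = e x y. Proof. exact: thin_off. Qed.

Lemma long_v b w : long b -> w \in b.2 -> w != v.
Proof. by move=> /andP[_ vb] wb; apply: contraNneq vb => <-. Qed.

Lemma block_prev b y : b \in bs -> y \in b.2 -> y != hd b -> prev c y \in b.2.
Proof.
move=> bbs yb yh; have [i [B [b' [_ h _ _]]]] := block_view hc cE bsX bs2 bbs.
have [p [x [q [E _ /andP[_ /eqP->] _]]]] := inner_split h yb yh.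
by rewrite prev_next // E mem_cat mem_rcons mem_head.
Qed.

Lemma count_set (A : {set T}) : {subset A <= c} -> count (mem A) c = #|A|.
Proof.
move=> Ac; rewrite -size_filter -(card_uniqP (filter_uniq _ uc)); apply: eq_card => x.
by rewrite mem_filter /=; case: (boolP (x \in A)) => // /Ac->.
Qed.

Lemma count_prev (P : pred T) : count (fun y => P (prev c y)) c = count P c.
Proof.
rewrite -(count_map (prev c)); apply/permP; apply: uniq_perm => //.
  by rewrite map_inj_uniq //; apply: can_inj (next_prev uc).
move=> y; apply/mapP/idP => [[x xc ->]|yc]; first by rewrite mem_prev.
by exists (next c y); rewrite ?mem_next ?prev_next.
Qed.

Lemma deg_part (S : {set T}) p : {subset S <= c} ->
  deg Rest p <= #|[set y in Rest | [&& y \in c, y \notin S & e p y]]| + deg S p + deg Outer p.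
Proof.
move=> Sc; rewrite /deg -sum1_card ![\sum_(y in _) _]big_mkcond -!big_split /=.
apply: leq_sum => y _; rewrite [y \in [set _ in _ | _]]in_set.
case: (boolP (y \in Rest)) => [yL|] //; have := Rest_split yL.
by case: (y \in c); case: (y \in S); case: (e p y); case: (y \in Outer).
Qed.

(* A neighbour w of the last vertex off the segment is charged to its successor;
   by insertion these successors avoid the neighbours of the first vertex, and
   all of them lie outside X and its successors. *)
Lemma ends_bound b : b \in bs -> long b ->
  deg Rest (hd b) + deg Rest (lst b) + 2 * #|X| <=
  size c + (size b.2).-1 + (deg Outer (hd b) + deg Outer (lst b)).
Proof.
move=> bbs lb; have /andP[sb vb] := lb.
pose S := [set y in b.2].
have Sc : {subset S <= c} by move=> y; rewrite inE; apply: (block_mem cE bbs).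
have pb := block_head_mem hc cE bsX bs2 bbs; have qb := block_last_mem hc cE bsX bs2 bbs.
have pv := long_v lb pb; have qv := long_v lb qb.
have ub : uniq b.2.
  have [i [B [b' [E _ _ _]]]] := block_view hc cE bsX bs2 bbs.
  by have := rot_uniq i c; rewrite uc E cat_uniq => /andP[].
have cS : #|S| = size b.2 by rewrite cardsE; apply/card_uniqP.
have := deg_lt ei (w := hd b) (A := S); rewrite inE pb cS => /(_ isT) hS1.
have := deg_lt ei (w := lst b) (A := S); rewrite inE qb cS => /(_ isT) hS2.
have hp := deg_part (hd b) Sc; have hq := deg_part (lst b) Sc.
set A := [set y in Rest | _] in hp; set D := [set y in Rest | _] in hq.
suff key : #|A| + #|D| + (size b.2).-1 + 2 * #|X| <= size c.
  by clear - key hp hq hS1 hS2; lia.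
have cA : count (mem A) c = #|A| by apply: count_set => y; rewrite in_set => /and3P[].
have cD : count (mem D) c = #|D| by apply: count_set => y; rewrite in_set => /and3P[].
have cX : count (mem X) c = #|X| by apply: count_set; apply: hc_Xc hc.
pose tl := S :\ hd b.
have ct : count (mem tl) c = (size b.2).-1.
  rewrite count_set; last by move=> y; rewrite in_setD1 => /andP[_ /Sc].
  by rewrite -cS (cardsD1 (hd b) S) inE pb.
(* [D] and one copy of X are shifted to successors. It remains to see that each [y] on the cycle
   carries at most one of the five indicators. *)
rewrite -cA -cD -ct -cX mul2n -addnn -{2}(count_prev (mem X)) -(count_prev (mem D)) -size_filter.
rewrite size_filter -!sum_count -!big_split /= -sum1_size big_seq [X in _ <= X]big_seq.
apply: leq_sum => y yc.
have tlb : y \in tl -> prev c y \in b.2 by rewrite !inE => /andP[yh yb]; apply: block_prev.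
have LX w : w \in X -> w \notin Rest by rewrite in_Rest => ->; rewrite andbF.
have AE : (y \in A) = [&& y \in Rest, y \notin b.2 & e (hd b) y].
  by rewrite in_set yc [y \in S]in_set.
have DE : (prev c y \in D) = [&& prev c y \in Rest, prev c y \notin b.2 & e (lst b) (prev c y)].
  by rewrite in_set mem_prev yc [_ \in S]in_set.
case: (boolP (y \in X)) => yX.
  have -> : (y \in A) = false by rewrite AE (negbTE (LX _ yX)).
  have -> : (y \in tl) = false.
    by apply: contraTF yX; rewrite !inE => /andP[_]; apply: bsN.
  rewrite (negbTE (prev_X hc yX)).
  case DD : (prev c y \in D) => //; move: DD; rewrite DE => /and3P[pL _].
  have [b' b'X qE] := block_lastE hc cE bsX bs2 bbs.
  by rewrite -f_e // ?Rest_neq_v // qE (negbTE (pred_indep fs fi hc b'X yX)).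
case: (boolP (prev c y \in X)) => pX.
  have -> : (prev c y \in D) = false by rewrite DE (negbTE (LX _ pX)).
  have -> : (y \in tl) = false by apply: contraTF pX => /tlb; apply: bsN.
  case AA : (y \in A) => //; move: AA; rewrite AE => /and3P[yL _].
  rewrite -f_e // ?Rest_neq_v // (block_headE hc cE bsX bs2 bbs).
  by have := succ_indep fs fi hc (bsX bbs) pX; rewrite next_prev // => /negbTE->.
case: (boolP (y \in tl)) => yt.
  have -> : (y \in A) = false by rewrite AE; move: yt; rewrite !inE => /andP[_ ->]; rewrite andbF.
  by have -> : (prev c y \in D) = false by rewrite DE tlb ?andbF.
rewrite !addn0; case AA : (y \in A) => //; case DD : (prev c y \in D) => //.
move: AA DD; rewrite AE DE => /and3P[yL yb epy] /and3P[wL wb eqw].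
have H := block_insertion fs hc cE bsX bsN bs2 bbs lb (w := prev c y)
  (etrans (mem_prev c y) yc) pX.
rewrite next_prev // in H.
move: yL wL; rewrite !in_Rest => /and4P[yv _ _ yY] /and4P[wv _ _ wY].
by have [_] := H yX wb wY yY; rewrite !f_e // epy eqw.
Qed.

(* By insertion, the two ends of any other segment send at most two edges to a
   pair of consecutive vertices. *)
Lemma dends_pair w : w \in c -> w \in Rest -> next c w \in Rest ->
  dends w + dends (next c w) <= 2 * nlong + 2 * count (fun b => long b && (w \in b.2)) bs.
Proof.
move=> wc wL nL.
have -> : 2 * nlong + 2 * count (fun b => long b && (w \in b.2)) bs =
    \sum_(b <- bs | long b) (2 + 2 * (w \in b.2)).
  rewrite /nlong -!sum_count !big_distrr -big_split [RHS]big_mkcond.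
  by apply: eq_bigr => b _; case: (long b).
rewrite /dends -big_split big_seq_cond [X in _ <= X]big_seq_cond /=.
apply: leq_sum => b /andP[bbs lb].
case: (boolP (w \in b.2)) => wb.
  by do 4![case: (e _ _)].
have wX : w \notin X by move: wL; rewrite in_Rest => /and4P[].
have nX : next c w \notin X by move: nL; rewrite in_Rest => /and4P[].
have wY : w \notin Y by move: wL; rewrite in_Rest => /and4P[].
have nY : next c w \notin Y by move: nL; rewrite in_Rest => /and4P[].
have [] := block_insertion fs hc cE bsX bsN bs2 bbs lb wc wX nX wb wY nY.
have hv := long_v lb (block_head_mem hc cE bsX bs2 bbs).
have lv := long_v lb (block_last_mem hc cE bsX bs2 bbs).
rewrite !f_e ?(Rest_neq_v wL) ?(Rest_neq_v nL) //.
rewrite ![e (block_head _ _) _]es ![e (block_last _ _) _]es.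
by do 4![case: (e _ _)].
Qed.

Lemma long_count_le1 w : count (fun b => long b && (w \in b.2)) bs <= 1.
Proof.
rewrite -sum_count; apply: sum_le1; first exact: bs_uniq hc cE.
by move=> b b' bbs bbs' /andP[_ wb] /andP[_ wb']; apply: (block_inj hc cE bbs bbs' wb wb').
Qed.

Lemma long_count0 b w : b \in bs -> ~~ long b -> w \in b.2 ->
  count (fun b => long b && (w \in b.2)) bs = 0.
Proof.
move=> bbs lb wb; apply/eqP; rewrite -leqn0 leqNgt -has_count; apply/hasPn => b' bbs'.
apply/negP => /andP[lb' wb']; case/negP: lb.
by rewrite (block_inj hc cE bbs bbs' wb wb').
Qed.

Lemma dends_le w : (forall b, b \in bs -> long b -> e w (hd b) + e w (lst b) <= 1) ->
  dends w <= nlong.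
Proof.
move=> H; rewrite /dends /nlong -sum1_count big_seq_cond [X in _ <= X]big_seq_cond.
by apply: leq_sum => b /andP[]; apply: H.
Qed.

(** First vertices are pairwise nonadjacent, so each long segment offers at most its last vertex. *)
Lemma dends_hd b : b \in bs -> hd b \in Rest -> dends (hd b) <= nlong.
Proof.
move=> bbs hL; apply: dends_le => // b' bbs' lb'.
have hv := long_v lb' (block_head_mem hc cE bsX bs2 bbs').
rewrite -f_e ?(Rest_neq_v hL) // (block_headE hc cE bsX bs2 bbs) (block_headE hc cE bsX bs2 bbs').
by rewrite (negbTE (succ_indep fs fi hc (bsX bbs) (bsX bbs'))) add0n leq_b1.
Qed.

Lemma dends_lst b : b \in bs -> lst b \in Rest -> dends (lst b) <= nlong.
Proof.
move=> bbs hL; apply: dends_le => // b' bbs' lb'.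
have hv := long_v lb' (block_last_mem hc cE bsX bs2 bbs').
have [x xX xE] := block_lastE hc cE bsX bs2 bbs; have [y yX yE] := block_lastE hc cE bsX bs2 bbs'.
have := negbTE (pred_indep fs fi hc xX yX).
by rewrite -xE -yE f_e ?(Rest_neq_v hL) // => ->; rewrite addn0 leq_b1.
Qed.

(** By [succ_common] and [pred_common], [r] sees at most one first and one last vertex. *)
Lemma dends_Outer r : r \in Outer -> dends r <= 2.
Proof.
move=> rR; have rv := Rest_neq_v (Outer_Rest rR); have rc : r \notin c by move: rR; rewrite inE => /andP[].
rewrite /dends big_split /= -!(big_filter bs) -[2]/(1 + 1).
have ub : uniq (filter long bs) by rewrite filter_uniq //; exact: bs_uniq hc cE.
apply: leq_add; apply: sum_le1 => // b b'; rewrite !mem_filter => /andP[lb bbs] /andP[lb' bbs'].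
  have hb := block_head_mem hc cE bsX bs2 bbs; have hb' := block_head_mem hc cE bsX bs2 bbs'.
  rewrite -!f_e ?(long_v lb hb) ?(long_v lb' hb') // => r1 r2.
  apply: (block_inj hc cE bbs bbs' hb); rewrite (block_headE hc cE bsX bs2 bbs).
  rewrite (block_headE hc cE bsX bs2 bbs) in r1; rewrite (block_headE hc cE bsX bs2 bbs') in r2.
  by rewrite (succ_common fs hc rc (bsX bbs) (bsX bbs') r1 r2) -(block_headE hc cE bsX bs2 bbs').
have hb := block_last_mem hc cE bsX bs2 bbs; have hb' := block_last_mem hc cE bsX bs2 bbs'.
rewrite -!f_e ?(long_v lb hb) ?(long_v lb' hb') // => r1 r2.
have [x xX xE] := block_lastE hc cE bsX bs2 bbs; have [y yX yE] := block_lastE hc cE bsX bs2 bbs'.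
apply: (block_inj hc cE bbs bbs' hb).
rewrite xE in r1; rewrite yE in r2.
by rewrite xE (pred_common fs hc rc xX yX r1 r2) -yE.
Qed.

Lemma Inner_Rest w : w \in Inner -> w \in Rest. Proof. by rewrite in_setD => /andP[]. Qed.

(** Within the rest, [w] sees [dends w] ends and at most |Inner| - 1 inner vertices; its other edges
    go to X + v. *)
Lemma deg_Inner w : w \in Inner -> k < deg Xhub w + dends w + #|Inner|.
Proof.
move=> wZ; rewrite -(deg_Rest (Inner_Rest wZ)) deg_ends addnA ltn_add2l.
exact: deg_lt.
Qed.

Lemma block_Inner b w : b \in bs -> w \in b.2 -> 1 < size b.2 -> w != v ->
  (long b -> w != hd b /\ w != lst b) -> w \in Inner.
Proof.
move=> bbs wb sb wv H; rewrite in_setD (block_Rest bbs wb sb wv) andbT in_set.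
apply/flatten_mapP => -[b']; rewrite mem_filter => /andP[lb' bbs'] wE; rewrite !inE in wE.
have wb' : w \in b'.2.
  by case/pred2P: wE => ->; [apply: (block_head_mem hc cE bsX bs2) | apply: (block_last_mem hc cE bsX bs2)].
have E := block_inj hc cE bbs bbs' wb wb'.
by rewrite -E in wE lb'; have [/negbTE h1 /negbTE h2] := H lb'; rewrite h1 h2 in wE.
Qed.

Lemma Outer_Inner r : r \in Outer -> r \in Inner.
Proof.
move=> rR; rewrite in_setD (Outer_Rest rR) andbT in_set; apply: contraTN rR => /flatten_mapP[b].
rewrite mem_filter => /andP[lb bbs] rE; rewrite !inE in rE.
have rb : r \in b.2.
  by case/pred2P: rE => ->; [apply: (block_head_mem hc cE bsX bs2) | apply: (block_last_mem hc cE bsX bs2)].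
by rewrite in_set (block_mem cE bbs rb).
Qed.

(** * Lower bounds for the edges from the rest to X + v, segment by segment *)

Section Sums.
Variables (b0 : T * seq T) (S1 S2 : seq T).
Hypotheses (b0bs : b0 \in bs) (b0E : b0.2 = S1 ++ v :: S2).

Lemma v_b0 : v \in b0.2. Proof. by rewrite b0E mem_cat mem_head orbT. Qed.

Lemma b0_notlong : ~~ long b0. Proof. by rewrite /is_long v_b0 andbF. Qed.

Lemma uniq_block b : b \in bs -> uniq b.2.
Proof.
move=> bbs; have [i [B [b' [E _ _ _]]]] := block_view hc cE bsX bs2 bbs.
by have := rot_uniq i c; rewrite uc E cat_uniq => /andP[].
Qed.

Lemma S12_v w : w \in S1 ++ S2 -> w != v.
Proof.
have := uniq_block b0bs; rewrite b0E -cat1s uniq_catCA /= => /andP[+ _] wS.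
by apply: contraNneq => <-.
Qed.

Lemma S12_b0 w : w \in S1 ++ S2 -> w \in b0.2.
Proof. by rewrite b0E !mem_cat inE => /orP[]->; rewrite ?orbT. Qed.

Lemma S12_Inner w : w \in S1 ++ S2 -> w \in Inner.
Proof.
move=> wS; apply: (block_Inner b0bs (S12_b0 wS) _ (S12_v wS)); last by rewrite (negbTE b0_notlong).
by move: wS; rewrite b0E size_cat /=; case: S1 => [|? ?]; case: S2 => //= *; rewrite addnS.
Qed.

(** The rest consists of the long segments, the two parts of the segment of [v], and [Outer]; the
    remaining segments are single vertices of Y. *)
Lemma sum_Rest (F : T -> nat) : \sum_(w in Rest) F w =
  \sum_(b <- bs | long b) \sum_(w <- b.2) F w +
  (\sum_(w <- S1) F w + \sum_(w <- S2) F w) + \sum_(r in Outer) F r.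
Proof.
have -> : \sum_(w in Rest) F w = \sum_(w <- c) (if w \in Rest then F w else 0) + \sum_(r in Outer) F r.
  rewrite big_mkcond; transitivity (\sum_(w in c) (if w \in Rest then F w else 0) + \sum_(r in Outer) F r);
    last by rewrite big_uniq.
  rewrite [X in _ = X + _]big_mkcond.
  rewrite [X in _ = _ + X]big_mkcond -big_split /=; apply: eq_bigr => w _.
  case: (boolP (w \in Rest)) => wL; last first.
    by rewrite (contraNF (@Outer_Rest w) wL); case: (w \in c).
  by have := Rest_split wL; case: (w \in c); case: (w \in Outer) => //=; rewrite addn0.
congr (_ + _); rewrite (sum_blocks cE).
have -> : \sum_(w <- S1) F w + \sum_(w <- S2) F w =
    \sum_(b <- bs) (if b == b0 then \sum_(w <- S1) F w + \sum_(w <- S2) F w else 0).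
  rewrite (bigD1_seq b0) //=; last exact: bs_uniq hc cE.
  by rewrite eqxx [X in _ = _ + X]big1 ?addn0 // => b /negbTE->.
rewrite [X in _ = X + _]big_mkcond -big_split /= big_seq [RHS]big_seq.
apply: eq_bigr => b bbs.
have -> : (b.1 \in Rest) = false by apply: contraTF (bsX bbs); rewrite in_Rest => /and4P[].
rewrite add0n; case: (eqVneq b b0) => [->|bb0].
  rewrite (negbTE b0_notlong) add0n b0E big_cat big_cons /=.
  have -> : (v \in Rest) = false by apply/negP => /Rest_neq_v; rewrite eqxx.
  rewrite add0n big_seq [X in _ + X]big_seq; congr (_ + _).
    by rewrite [RHS]big_seq; apply: eq_bigr => w wS; rewrite Inner_Rest // S12_Inner // mem_cat wS.
  by rewrite [RHS]big_seq; apply: eq_bigr => w wS; rewrite Inner_Rest // S12_Inner // mem_cat wS orbT.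
rewrite addn0; case: ifP => lb.
  by rewrite big_seq [RHS]big_seq; apply: eq_bigr => w wb; rewrite (long_Rest bbs lb wb).
have vb : v \notin b.2.
  by apply: contraNN bb0 => vb; apply/eqP; apply: (block_inj hc cE bbs b0bs vb v_b0).
rewrite big_seq big1 // => w wb.
have wv : w != v by apply: contraNneq vb => <-.
have sb : size b.2 = 1.
  move: lb; rewrite /is_long vb andbT; have := block_ne hc cE bsX bs2 bbs.
  by case: (b.2) => [|? [|? ?]].
have wY := block_single hc cE bsX bs2 bbs wb sb wv.
by rewrite in_Rest wY !andbF.
Qed.

Variable g : nat.
Hypothesis gE : g + nlong + #|Inner| = k.

(** By [deg_Inner] and [dends_pair], a consecutive pair sends at least 2 (g + 1) edges to X + v, as
    no long segment contains it; [dends_hd] gives the bound for the first vertex alone. *)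
Lemma S1_sum : g.+1 * size S1 <= \sum_(w <- S1) deg Xhub w.
Proof.
have Sv w : w \in S1 -> w \in S1 ++ S2 by rewrite mem_cat => ->.
case E : S1 => [|x t]; first by rewrite muln0.
apply: pair_sum_head => [s1 w w' s2 Ew|].
  rewrite -E in Ew; have E2 : b0.2 = s1 ++ w :: w' :: (s2 ++ v :: S2) by rewrite b0E Ew -catA.
  have w'E := block_step hc cE bsX bs2 b0bs E2.
  have wZ : w \in Inner by apply/S12_Inner/Sv; rewrite Ew mem_cat mem_head orbT.
  have w'Inner : w' \in Inner by apply/S12_Inner/Sv; rewrite Ew mem_cat !inE eqxx !orbT.
  have wb : w \in b0.2 by apply/S12_b0/Sv; rewrite Ew mem_cat mem_head orbT.
  have := dends_pair (block_mem cE b0bs wb) (Inner_Rest wZ); rewrite -w'E => /(_ (Inner_Rest w'Inner)).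
  rewrite (long_count0 b0bs b0_notlong wb).
  by have := deg_Inner wZ; have := deg_Inner w'Inner; clear - gE; lia.
have hx : hd b0 = x by rewrite /block_head b0E E.
have xZ : x \in Inner by apply/S12_Inner/Sv; rewrite E mem_head.
have := deg_Inner xZ; have := dends_hd b0bs; rewrite hx => /(_ (Inner_Rest xZ)); clear - gE; lia.
Qed.

(** Mirror image: after reversal the last vertex of the segment heads the list, and [dends_lst]
    bounds it. *)
Lemma S2_sum : g.+1 * size S2 <= \sum_(w <- S2) deg Xhub w.
Proof.
have Sv w : w \in S2 -> w \in S1 ++ S2 by rewrite mem_cat => ->; rewrite orbT.
rewrite (perm_big (rev S2)) /=; last by rewrite perm_sym perm_rev.
rewrite -size_rev; case E : (rev S2) => [|x t]; first by rewrite muln0.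
apply: pair_sum_head => [s1 w' w s2 Ew|].
  rewrite -E in Ew; have Ew2 : S2 = rev s2 ++ w :: w' :: rev s1.
    by rewrite -(revK S2) Ew rev_cat !rev_cons -!cats1 -!catA.
  have E2 : b0.2 = (S1 ++ v :: rev s2) ++ w :: w' :: rev s1 by rewrite b0E Ew2 -catA.
  have w'E := block_step hc cE bsX bs2 b0bs E2.
  have wZ : w \in Inner by apply/S12_Inner/Sv; rewrite Ew2 mem_cat mem_head orbT.
  have w'Inner : w' \in Inner by apply/S12_Inner/Sv; rewrite Ew2 mem_cat !inE eqxx !orbT.
  have wb : w \in b0.2 by apply/S12_b0/Sv; rewrite Ew2 mem_cat mem_head orbT.
  have := dends_pair (block_mem cE b0bs wb) (Inner_Rest wZ); rewrite -w'E => /(_ (Inner_Rest w'Inner)).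
  rewrite (long_count0 b0bs b0_notlong wb).
  by have := deg_Inner wZ; have := deg_Inner w'Inner; clear - gE; lia.
have Ex : S2 = rcons (rev t) x by rewrite -(revK S2) E rev_cons.
have hx : lst b0 = x by rewrite /block_last b0E Ex last_cat /= last_rcons.
have xZ : x \in Inner by apply/S12_Inner/Sv; rewrite Ex mem_rcons mem_head.
have := deg_Inner xZ; have := dends_lst b0bs; rewrite hx => /(_ (Inner_Rest xZ)); clear - gE; lia.
Qed.

(** The two ends are covered by [ends_bound]. Inside, [dends_pair] may lose 2 to the segment itself,
    so a pair yields 2 g instead of 2 (g + 1), and nothing makes up for odd length. *)
Lemma long_sum b : b \in bs -> long b ->
  2 * k + g * (size b.2 - 2) + 2 * #|X| <= \sum_(w <- b.2) deg Xhub w + size c + (size b.2).-1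
    + (deg Outer (hd b) + deg Outer (lst b)) + g * odd (size b.2 - 2).
Proof.
move=> bbs lb; have := ends_bound bbs lb.
have := deg_Rest (long_Rest bbs lb (block_head_mem hc cE bsX bs2 bbs)).
have := deg_Rest (long_Rest bbs lb (block_last_mem hc cE bsX bs2 bbs)).
have [mid E] : exists mid, b.2 = hd b :: rcons mid (lst b).
  case/andP: lb => sb _; rewrite /block_head /block_last; case: (b.2) sb => [|x [|y t]] //= _.
  by exists (belast y t); rewrite -lastI.
suff : g * size mid <= \sum_(w <- mid) deg Xhub w + g * odd (size mid).
  have -> : size b.2 = (size mid).+2 by rewrite E /= size_rcons.
  have -> : \sum_(w <- b.2) deg Xhub w = deg Xhub (hd b) + (\sum_(w <- mid) deg Xhub w + deg Xhub (lst b)).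
    by rewrite {1}E big_cons -cats1 big_cat big_seq1.
  by rewrite !subSS subn0 /=; clear; lia.
apply: pair_sum => s1 w w' s2 Ew.
have ub := uniq_block bbs; rewrite E Ew in ub.
have E2 : b.2 = (hd b :: s1) ++ w :: w' :: rcons s2 (lst b).
  by rewrite E Ew rcons_cat.
have w'E := block_step hc cE bsX bs2 bbs E2.
have midZ x : x \in mid -> x \in Inner.
  move=> xm; have /andP[sb vb] := lb.
  have xb : x \in b.2 by rewrite E inE mem_rcons inE xm !orbT.
  apply: (block_Inner bbs xb sb (long_v lb xb)) => _.
  move: ub; rewrite -Ew /= mem_rcons inE negb_or rcons_uniq => /andP[/andP[_ h1] /andP[h2 _]].
  by split; [apply: contraNneq h1 => <- | apply: contraNneq h2 => <-].
have wZ : w \in Inner by apply: midZ; rewrite Ew mem_cat mem_head orbT.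
have w'Inner : w' \in Inner by apply: midZ; rewrite Ew mem_cat !inE eqxx !orbT.
have wb : w \in b.2 by rewrite E2 mem_cat mem_head orbT.
have := dends_pair (block_mem cE bbs wb) (Inner_Rest wZ); rewrite -w'E => /(_ (Inner_Rest w'Inner)).
have := long_count_le1 w.
by have := deg_Inner wZ; have := deg_Inner w'Inner; clear - gE; lia.
Qed.

Lemma sum_long_const (m : nat) : \sum_(b <- bs | long b) m = m * nlong.
Proof. by rewrite /nlong -sum1_count big_distrr /=; apply: eq_bigr => b _; rewrite muln1. Qed.

Definition nmid := \sum_(b <- bs | long b) (size b.2 - 2).
Definition nodd := \sum_(b <- bs | long b) odd (size b.2 - 2).
Definition ends_Outer := \sum_(r in Outer) dends r.

Lemma nodd_le : nodd <= nlong /\ nodd <= nmid.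
Proof.
split; first by rewrite -[nlong]mul1n -sum_long_const; apply: leq_sum => b _; apply: leq_b1.
by apply: leq_sum => b _; case: (size b.2 - 2) => //= n; case: (odd n).
Qed.

Lemma sum_all_long : 2 * k * nlong + g * nmid + 2 * #|X| * nlong <=
  \sum_(b <- bs | long b) \sum_(w <- b.2) deg Xhub w + size c * nlong + (nmid + nlong) + ends_Outer + g * nodd.
Proof.
have -> : ends_Outer = \sum_(b <- bs | long b) (deg Outer (hd b) + deg Outer (lst b)).
  rewrite /ends_Outer /dends exchange_big /=; apply: eq_bigr => b _; rewrite big_split /=.
  by congr (_ + _); apply: eq_bigr => r _; rewrite es.
have -> : nmid + nlong = \sum_(b <- bs | long b) (size b.2).-1.
  rewrite -[nlong]mul1n -sum_long_const -big_split /=; apply: eq_bigr => b /andP[].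
  by case: (size b.2) => [|[|m]] // _ _; rewrite !subSS subn0 addn1.
rewrite -!sum_long_const /nmid /nodd !big_distrr -!big_split big_seq_cond [X in _ <= X]big_seq_cond.
by apply: leq_sum => b /andP[bbs lb]; apply: long_sum.
Qed.

Lemma sum_Outer : k.+1 * #|Outer| <= \sum_(r in Outer) deg Xhub r + ends_Outer + #|Outer| * #|Inner|.
Proof.
rewrite mulnC -!sum_nat_const -!big_split /=; apply: leq_sum => r rR.
exact: deg_Inner (Outer_Inner rR).
Qed.

Lemma ends_Outer_le : ends_Outer <= 2 * #|Outer|.
Proof. by rewrite mulnC -sum_nat_const; apply: leq_sum => r; apply: dends_Outer. Qed.

Lemma card_Inner : #|Inner| = nmid + (size S1 + size S2) + #|Outer|.
Proof.
have := sum_Rest (fun=> 1); rewrite sum1_card card_Rest !sum1_size sum1_card.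
have -> : \sum_(b <- bs | long b) \sum_(w <- b.2) 1 = nmid + 2 * nlong.
  rewrite -sum_long_const -big_split /=; apply: eq_bigr => b /andP[sb _].
  by rewrite sum1_size subnK.
clear; lia.
Qed.

Lemma sum_trivial : k.+1 * #|Rest| <= \sum_(w in Rest) deg Xhub w + #|Rest| * #|Rest|.
Proof.
rewrite mulnC -!sum_nat_const -!big_split /=; apply: leq_sum => w wL.
by rewrite -(deg_Rest wL) ltn_add2l; apply: deg_lt.
Qed.

Lemma card_all : #|T| = #|X|.+1 + #|Y|.+1 + #|Rest|.
Proof.
have cX : #|Xhub| = #|X|.+1 by rewrite cardsU1 (hc_Xv hc).
have cY : #|Yfull| = #|Y|.+1.
  by rewrite cardsU1; have -> : v0 \notin Y by apply: contra (hc_v0 hc); apply: hc_Yc hc _.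
rewrite -(cardsC (Xhub :|: Yfull)) -/Rest cardsU cX cY (_ : Xhub :&: Yfull = set0) ?cards0 ?subn0 //.
apply/setP => w; rewrite in_setI in_set0; case: (boolP (w \in Xhub)) => // /hub_disj/negbTE->//.
Qed.

Lemma card_Outer : #|T| = (size c).+1 + #|Outer|.
Proof.
rewrite -(card_uniqP uc) -(cardsE (mem c)) -(cardsC (v0 |: [set x in c])) cardsU1 inE (hc_v0 hc).
by congr (_ + _); apply: eq_card => w; rewrite !inE negb_or andbC.
Qed.

(** If [S1] is empty, the predecessor of [v] lies in X, and likewise [S2] and the successor; these
    two vertices are [u] and [z]. *)
Lemma eps_S12 : 2 <= size S1 + size S2 + eps.
Proof.
have hv : (S1 == [::]) <= (prev c v \in X).
  case E : S1 => [|//]; have := block_headE hc cE bsX bs2 b0bs; rewrite /block_head b0E E /= => ->.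
  by rewrite prev_next // bsX.
have lv : (S2 == [::]) <= (next c v \in X).
  case E : S2 => [|//]; have [x xX] := block_lastE hc cE bsX bs2 b0bs.
  by rewrite /block_last b0E E last_cat /= => {1}->; rewrite next_prev // xX.
have hs : 1 <= size S1 + (S1 == [::]) by case: S1.
have ls : 1 <= size S2 + (S2 == [::]) by case: S2.
have -> : eps = (prev c v \in X) + (next c v \in X).
  by rewrite /eps; case: (nbrs_v es (hc_long hc) sc) => -[-> ->]; rewrite // addnC.
by clear - hv lv hs ls; lia.
Qed.

End Sums.

Lemma no_rest : #|T| <= 3 * k - 6 -> 3 < k -> k <= #|X|.+1 -> nlong = 0 /\ #|Rest| = 0.
Proof.
move=> hn k4 kX.
have [b0 b0bs vb0] := block_exists cE bsX vc (hc_Xv hc).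
have [S1 [S2 b0E]] : exists S1 S2, b0.2 = S1 ++ v :: S2.
  by case/splitPr: vb0 => S1 S2; exists S1, S2.
have cT := card_all; have cT' := card_Outer; have cL := card_Rest.
have cX : #|X| = #|Y| + nlong + 1 := count_blocks hc cE bsX bsN bs2.
(* The size bounds force s + |Inner| <= k, so the truncated subtractions are exact. *)
have gE : k - nlong - #|Inner| + nlong + #|Inner| = k by clear - hn k4 kX cT cL cX; lia.
have [s0 Z0] : nlong = 0 /\ #|Inner| = 0.
  have [o1 o2] := nodd_le.
  apply: (segment_counting (n := #|T|) (S := \sum_(w in Rest) deg Xhub w) edge_count edges_in_X cX cT' _
    (card_Inner b0bs b0E) (sum_Rest b0bs b0E (deg Xhub)) (sum_all_long gE) _ sum_Outer ends_Outer_le o1 o2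
    (eps_S12 b0bs b0E) _ hn kX k4 gE).
  - by rewrite cT cL.
  - by rewrite mulnDr leq_add //; [apply: S1_sum b0E _ gE | apply: S2_sum b0E _ gE].
  - by rewrite -cL; apply: sum_trivial.
by rewrite cL s0 Z0.
Qed.

End Count.

(** * Existence of a longest cycle and end of the proof *)

Lemma longest_exists (T : finType) (f : rel T) v c0 : uniq c0 -> cycle f c0 -> v \in c0 ->
  exists2 c, longest f v c & size c0 <= size c.
Proof.
move=> uc0 cc0 vc0.
pose P n := [exists t : n.-tuple T, [&& uniq t, cycle f t & v \in t]].
have P0 c : uniq c -> cycle f c -> v \in c -> P (size c).
  by move=> uc cc vc; apply/existsP; exists (in_tuple c); rewrite /= uc cc vc.
have Pm n : P n -> n <= #|T|.
  by case/existsP => t /and3P[ut _ _]; rewrite -(size_tuple t) -(card_uniqP ut) max_card.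
have ex : exists n, P n by exists (size c0); apply: P0.
case: (ex_maxnP ex Pm) => n /existsP[t /and3P[ut ct vt]] mx.
exists t; last by rewrite size_tuple; apply/mx/P0.
by split=> // c' uc' cc' vc'; rewrite size_tuple; apply/mx/P0.
Qed.

(** A path from [u] to [z] avoiding [v] is closed up through [v]. *)
Lemma initial_cycle (T : finType) (e : rel T) u v z : symmetric e ->
  uniq [:: u; v; z] -> e u v -> e v z -> connected_minus e [set v] ->
  exists c, [/\ uniq c, cycle (thin e u v z) c, v \in c & 2 < size c].
Proof.
move=> es uvz euv evz cv; have [uv zv uz] := uvz_neq uvz.
have /connectP[p0 pp zE] : connect (induced_rel e (~: [set v])) u z by apply: cv; rewrite !inE.
case: (shortenP pp) zE => p pp' up _ zE.
have pv : v \notin u :: p.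
  rewrite inE negb_or eq_sym uv /=; elim: (p) (u) pp' => //= w q IH x /andP[/and3P[_ wv _] /IH].
  by rewrite !inE in wv *; rewrite negb_or eq_sym wv.
have pf : path (thin e u v z) u p.
  by apply: sub_path pp' => x y /and3P[]; rewrite !inE => xv yv; rewrite thin_off.
have fvu : thin e u v z v u by rewrite /thin es euv !inE !eqxx (negbTE uv).
have fzv : thin e u v z z v by rewrite /thin es evz !inE !eqxx (negbTE zv) orbT.
exists (v :: u :: p); split; rewrite ?mem_head //; first by rewrite cons_uniq pv.
  by rewrite /= fvu rcons_path pf -zE fzv.
by case: p zE {pp' up pv pf} => //= E; rewrite E eqxx in uz.
Qed.

Theorem theorem5 (T : finType) (e : rel T) (k : nat) (u v z : T) :
  simple_graph e ->
  0 < k ->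
  k_connected e 3 ->
  regular e k ->
  uniq [:: u; v; z] -> e u v -> e v z ->
  connected_minus e [set u; v; z] ->
  ~ in_class_H e k u v z ->
  #|T| <= 3 * k - 6 ->
  exists c : seq T,
    hamiltonian_cycle e c /\ cycle_has_edge c u v /\ cycle_has_edge c v z.
Proof.
move=> [es ei] _ conn ereg uvz euv evz connP nH hn.
have [uv zv uz] := uvz_neq uvz.
have k4 := k_gt3 v ei ereg conn hn.
pose f := thin e u v z.
have fs : symmetric f by exact: thin_sym.
have fi : irreflexive f by exact: thin_irr.
have fuv : f u v by rewrite /f /thin euv !inE !eqxx (negbTE uv).
have fvz : f v z by rewrite /f /thin evz !inE !eqxx (negbTE zv) orbT.
have [c0 [uc0 cc0 vc0 sc0]] : exists c, [/\ uniq c, cycle f c, v \in c & 2 < size c].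
  by apply: initial_cycle => //; case: conn => _; apply; rewrite cards1.
have [c lc sc0c] := longest_exists uc0 cc0 vc0.
have sc : 2 < size c by apply: leq_trans sc0 sc0c.
have [uc cc vc _] := lc.
have nb := nbrs_v es lc sc.
case: (boolP [forall x, x \in c]) => [/forallP call|].
  exists c; split; first split=> //.
    by apply: sub_cycle cc => x y; apply: thin_sub.
  rewrite /cycle_has_edge; case: nb => -[nv pv].
    by split; right; rewrite // -pv next_prev.
  by split; left; rewrite // -pv next_prev.
rewrite negb_forall => /existsP[v0 v0c]; exfalso.
have v0v : v0 != v by apply: contraNneq v0c => ->.
(* Stated for every longest cycle, since the exchange argument changes the cycle. *)
have out c' x y : longest f v c' -> size c <= size c' -> x \notin c' -> y \notin c' -> ~~ f x y.
  move=> lc' sc' xc yc; apply: contra (@thin_sub _ e u v z x y) _.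
  exact: (longest_outside es ei ereg uvz conn euv evz connP hn lc' (leq_trans sc sc') xc yc).
have adjv y : f v y -> adj c v y.
  move=> /thin_v; rewrite !inE.
  by case: nb => -[<- <-] /pred2P[]->; rewrite ?adj_next ?(adj_prev lc).
have [X [Y hc0]] := hop_exists fs fi lc sc v0c out adjv.
have kX : k <= #|X|.+1.
  apply: leq_trans (thin_deg u z ereg v0v) _; rewrite ltnS; apply: subset_leq_card.
  by apply/subsetP => x; rewrite inE; apply: (hc_nbr hc0); rewrite setU11.
have [a aX] : exists a, a \in X.
  by apply/card_gt0P; move: k4 kX; clear; lia.
(* The cycle is rotated to start in X, so nothing precedes the first block. *)
have [i s cE] := rot_to (hc_Xc hc0 aX).
have hc := hop_rot i hc0.
have [t [bs [sE ht hbs]]] := blocks_exist (mem X) (rot i c).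
have t0 : t = [::] by case: t sE ht => // b t; rewrite cE => -[<- _]; rewrite /= aX.
rewrite {}t0 /= in sE {ht}.
have bsX b : b \in bs -> b.1 \in X by move/(allP hbs) => /andP[].
have bsN b w : b \in bs -> w \in b.2 -> w \notin X.
  by move/(allP hbs) => /andP[_ /hasPn h] /h.
have bs2 : 1 < size bs by rewrite -(card_X hc sE bsX bsN); move: k4 kX; clear; lia.
have sc' : 2 < size (rot i c) by rewrite size_rot.
have [s0 L0] := no_rest es ei ereg uvz euv evz hc sE bsX bsN bs2 sc' hn k4 kX.
have cX : #|X| = #|Y|.+1.
  by rewrite (count_blocks hc sE bsX bsN bs2) -/(nlong v bs) s0 addn0 addn1.
have cT := card_all hc.
rewrite L0 addn0 -cX in cT.
(* The rest is empty, and a vertex of Y + v0 has its [f]-neighbours in X, which omits [v]. *)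
have inX x : f x v -> x \in Xhub v X.
  move=> fxv; have : x \notin Rest v v0 X Y.
    by move/eqP: L0; rewrite cards_eq0 => /eqP->; rewrite inE.
  rewrite in_setC negbK in_setU => /orP[//|xY].
  by have := hc_Xv hc; rewrite (hc_nbr hc xY fxv).
have uX := inX _ fuv.
have zX : z \in Xhub v X by apply: inX; rewrite fs.
have cY0 : #|Yfull v0 Y| = #|X|.
  rewrite cX cardsU1; have -> : v0 \notin Y by apply: contra (hc_v0 hc); apply: hc_Yc hc _.
  by [].
have cXv : #|Xhub v X| = #|X|.+1 by rewrite cardsU1 (hc_Xv hc).
have Ynb y x : y \in Yfull v0 Y -> e y x -> x \in Xhub v X by apply: (Yfull_nbr hc).
have XYd x : x \in Xhub v X -> x \notin Yfull v0 Y by apply: (hub_disj hc).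
case: nH; exists #|X|; split=> //.
(* If |X| = k - 1, every vertex of Y + v0 is adjacent to all of X + v. Then [v] sees these k - 1
   vertices as well as [u] and [z], more than k in all. *)
- rewrite leqNgt; apply/negP => Xk.
  have kE : k = #|X|.+1 by move: kX Xk; clear; lia.
  have all_v y : y \in Yfull v0 Y -> e v y.
    move=> yY; have : nbhd e y = Xhub v X.
      apply/eqP; rewrite eqEcard ereg cXv kE leqnn andbT.
      by apply/subsetP => x; rewrite inE; apply: Ynb.
    by move/setP/(_ v); rewrite inE setU11 es.
  have : u |: (z |: Yfull v0 Y) \subset nbhd e v.
    apply/subsetP => x; rewrite !in_setU1 !inE => /or3P[/eqP->|/eqP->|] //; first by rewrite es.
    by move=> xY; apply: all_v; rewrite in_setU1.
  move=> /subset_leq_card; rewrite ereg cardsU1 cardsU1 in_setU1 (negbTE uz) (XYd _ uX) (XYd _ zX) cY0 kE.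
  by clear; lia.
- by rewrite cT -addnn; clear; lia.
- by case: conn => h1 h2; split; [apply: ltnW | move=> S h; apply: h2; apply: ltnW].
exists (Xhub v X), (Yfull v0 Y); split=> //.
- by rewrite disjoints_subset; apply/subsetP => x /XYd; rewrite in_setC.
- by move=> x y xY yY; apply/negP => /(Ynb _ _ xY)/XYd; rewrite yY.
- by split=> //; apply: setU11.
- split; last by rewrite es euv evz.
  apply/subsetP => x; rewrite inE => /exists_inP[y yY].
  exact: Ynb.
Qed.
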